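(* Let $\Phi$ be an irreducible crystallographic root system with positive system $\Phi^+$, let $k$ be a positive integer, let $R$ be a dominant region of the $k$-Catalan arrangement of $\Phi$, let $\mathcal{I}=\theta(R)$, and let $\alpha\in\Phi^+$. Then $R$ contains an alcove $B$ such that for all $r\in\{1,\ldots,k\}$ the following are equivalent: (1) $H_\alpha^r$ is a ceiling of $R$; (2) $\alpha$ is a rank $r$ indecomposable element of $\mathcal{I}$; (3) $H_\alpha^r$ is a ceiling of $B$.
   Context: $\Phi$ lives in a real Euclidean space $V$ with inner product $\langle\cdot,\cdot\rangle$, simple system $S$. $H_\alpha^r=\{x\in V\mid\langle x,\alpha\rangle=r\}$. The $k$-Catalan arrangement consists of the $H_\alpha^r$ with $\alpha\in\Phi$, $r\in\{0,\ldots,k\}$; regions are connected components of its complement; $R$ is dominant if $\langle x,\alpha\rangle>0$ for all $\alpha\in\Phi^+$, $x\in R$. Walls of a region (or alcove) are hyperplanes of the relevant arrangement supporting a facet of it; a ceiling is a wall not containing the origin such that the origin is on the same side of it as the region. The affine Coxeter arrangement consists of all $H_\alpha^r$ with $\alpha\in\Phi$, $r\in\mathbb{Z}$; alcoves are the connected components of its complement, and a ceiling of an alcove $B$ is a hyperplane of the affine Coxeter arrangement supporting a facet of $B$, not containing the origin, with the origin on the same side as $B$. The root poset is $\Phi^+$ with $\alpha\le\beta$ iff $\beta-\alpha$ is a nonnegative integer combination of $S$; an ideal is a down-closed subset. For a dominant region $R$, $\theta(R)=(I_1,\ldots,I_k)$ with $I_i=\{\alpha\in\Phi^+\mid\langle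 x,\alpha\rangle<i\text{ for all }x\in R\}$ (an ascending chain of ideals). For a chain $\mathcal{I}=(I_1,\ldots,I_K)$ of ideals and $\alpha\in\Phi^+$, $r_\alpha(\mathcal{I})=\min\{r_1+\cdots+r_m\mid \alpha=\alpha_1+\cdots+\alpha_m,\ \alpha_i\in I_{r_i},\ r_i\in\{1,\ldots,K\}\}$, and $r_\alpha(\mathcal{I})=\infty$ if no such decomposition exists. Setting $I_0=\varnothing$, an element $\alpha\in\Phi^+$ is a rank $r$ indecomposable element of $\mathcal{I}$ if $\alpha\in I_r$ and (i) $r_\alpha(\mathcal{I})=r$; (ii) $\alpha\notin I_i+I_j=\{\beta+\gamma\mid\beta\in I_i,\gamma\in I_j\}$ whenever $i+j=r$; (iii) whenever $\beta\in\Phi^+$ and $r_{\alpha+\beta}(\mathcal{I})=t\le K$, then $\beta\in I_{t-r}$. *)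

(* Defs.v *)
(* V = 'rV[R]_n with R : realType,
   inner product <u,v> = u *m v^T (the standard one; every finite-dimensional
   real Euclidean space is isometric to this). *)
From mathcomp Require Import all_boot all_order all_algebra.
From mathcomp Require Import all_classical all_reals all_analysis.
Set Implicit Arguments. Unset Strict Implicit. Unset Printing Implicit Defensive.
Import Order.TTheory GRing.Theory Num.Theory.
Import numFieldNormedType.Exports.
Local Open Scope classical_set_scope.
Local Open Scope ring_scope.

Section Defs.
Variables (R : realType) (n : nat).
Local Notation V := 'rV[R]_n.

Definition dot (u v : V) : R := (u *m v^T) 0 0.

Definition hyp (a : V) (c : R) : set V := [set x | dot x a = c].

Definition refl (a x : V) : V := x - ((2 * dot x a) / dot a a) *: a.

Definition spans (s : seq V) : Prop :=
  forall v : V, exists c : 'I_(size s) -> R, v = \sum_(i < size s) c i *: s`_i.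

Definition lin_indep (s : seq V) : Prop :=
  forall c : 'I_(size s) -> R, \sum_(i < size s) c i *: s`_i = 0 -> forall i, c i = 0.

Definition crystallographic_root_system (Phi : seq V) : Prop :=
  [/\ spans Phi,
      (forall a, a \in Phi -> a != 0),
      (forall a b, a \in Phi -> b \in Phi -> refl a b \in Phi),
      (forall a (c : R), a \in Phi -> c *: a \in Phi -> c = 1 \/ c = -1)
    & (forall a b, a \in Phi -> b \in Phi ->
         exists z : int, (2 * dot b a) / dot a a = z%:~R)].

Definition irreducible_rs (Phi : seq V) : Prop :=
  forall P : V -> Prop,
    (exists a, a \in Phi /\ P a) -> (exists a, a \in Phi /\ ~ P a) ->
    exists a b, [/\ a \in Phi, b \in Phi, P a, ~ P b & dot a b != 0].

Definition irreducible_crystallographic_root_system (Phi : seq V) : Prop :=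
  crystallographic_root_system Phi /\ irreducible_rs Phi.

Definition simple_system (Phi S : seq V) : Prop :=
  [/\ {subset S <= Phi}, lin_indep S &
      forall a, a \in Phi -> exists c : 'I_(size S) -> R,
        a = \sum_(i < size S) c i *: S`_i /\
        ((forall i, 0 <= c i) \/ (forall i, c i <= 0))].

Definition pos_root (Phi S : seq V) (a : V) : Prop :=
  a \in Phi /\ exists c : 'I_(size S) -> R,
    a = \sum_(i < size S) c i *: S`_i /\ (forall i, 0 <= c i).

Definition arr_complement (A : set (set V)) : set V :=
  [set x | forall H, A H -> ~ H x].

Definition is_region (A : set (set V)) (Reg : set V) : Prop :=
  exists x, arr_complement A x /\ Reg = @connected_component V (arr_complement A) x.

Definition catalan_arr (Phi : seq V) (k : nat) : set (set V) :=
  [set H | exists a (r : nat), [/\ a \in Phi, (r <= k)%N & H = hyp a r%:R]].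

Definition affine_arr (Phi : seq V) : set (set V) :=
  [set H | exists a (r : int), a \in Phi /\ H = hyp a r%:~R].

(* H is a wall of Reg: H is a hyperplane of A supporting a facet of Reg, i.e.
   H meets the closure of Reg in a relatively open (codimension-one) piece *)
Definition wall (A : set (set V)) (Reg H : set V) : Prop :=
  A H /\ exists x, H x /\ \forall y \near (x : V), H y -> @closure V Reg y.

(* ceiling: a wall not containing the origin, with the origin on the same side
   of it as Reg (no segment from 0 to a point of Reg meets H) *)
Definition ceiling (A : set (set V)) (Reg H : set V) : Prop :=
  [/\ wall A Reg H, ~ H 0 &
      forall x (t : R), Reg x -> 0 <= t <= 1 -> ~ H (t *: x)].

Definition dominant (Phi S : seq V) (Reg : set V) : Prop :=
  forall x a, Reg x -> pos_root Phi S a -> 0 < dot x a.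

Definition theta (Phi S : seq V) (k : nat) (Reg : set V) : nat -> set V :=
  fun i => if (0 < i <= k)%N then
             [set a | pos_root Phi S a /\ forall x, Reg x -> dot x a < i%:R]
           else set0.

Definition rdecomp (I : nat -> set V) (K : nat) (v : V) (t : nat) : Prop :=
  exists s : seq (V * nat),
    [/\ s != [::],
        (forall p, p \in s -> I p.2 p.1 /\ (0 < p.2 <= K)%N),
        \sum_(p <- s) p.1 = v
      & (\sum_(p <- s) p.2)%N = t].

Definition rank_eq (I : nat -> set V) (K : nat) (v : V) (t : nat) : Prop :=
  rdecomp I K v t /\ forall t', rdecomp I K v t' -> (t <= t')%N.

(* a is a rank r indecomposable element of the chain I = (I_1,...,I_K)
   (with I_0 = empty; I_j for j <= 0 is empty, via truncated subtraction) *)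
Definition rank_indecomposable (Phi S : seq V) (I : nat -> set V) (K : nat)
    (a : V) (r : nat) : Prop :=
  [/\ I r a,
      rank_eq I K a r,
      (forall i j, (i + j)%N = r ->
         ~ exists b c, [/\ I i b, I j c & a = b + c])
    & (forall b (t : nat), pos_root Phi S b -> pos_root Phi S (a + b) ->
         rank_eq I K (a + b) t -> (t <= K)%N -> I (t - r)%N b)].

End Defs.

(* Main.v *)
(* The region R and the alcoves inside it are sign cells of affine forms, so
   (1) => (2) is read off a facet, and (3) => (1) holds for every alcove B
   contained in R.  The heart is (2) => (3) for a suitable B.

   Write k_a(x) for the integer with k_a(x) - 1 <= <x,a> < k_a(x).  Choose a
   generic x in R maximizing the sum of k_a(x) over the positive roots a that
   are bounded on R, and push x far away in a direction which increases exactly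
   the other positive roots.  Walk from x orthogonally towards the hyperplane
   <.,d> = k_d(x): either no other hyperplane of a bounded root is crossed, or
   the first one crossed splits d = b + e into roots with k_d = k_b + k_e.
   By maximality the first alternative forces k_d <= k.  Hence, by induction on
   k_d(x) - <x,d>, every bounded d is a sum of elements of the ideals with total
   rank k_d(x).  Combined with indecomposability, this rules out the second
   alternative for d = alpha, so the walk from x reaches the hyperplane of
   alpha first, and B is the alcove just before it. *)
Require Import Defs.
From HB Require Import structures.
From mathcomp Require Import all_boot all_order all_algebra.
From mathcomp Require Import all_classical all_reals all_analysis.
From mathcomp Require Import ring lra zify.
Set Implicit Arguments. Unset Strict Implicit. Unset Printing Implicit Defensive.
Import Order.TTheory GRing.Theory Num.Theory.
Import numFieldNormedType.Exports.
Local Open Scope classical_set_scope.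
Local Open Scope ring_scope.

(** * Bilinearity and positive definiteness of the inner product *)

Section Dot.
Variables (R : realType) (n : nat).
Implicit Types u v w : 'rV[R]_n.

Lemma dotE u v : dot u v = \sum_j u 0 j * v 0 j.
Proof. by rewrite /dot mxE; apply: eq_bigr => j _; rewrite mxE. Qed.

Lemma dotC u v : dot u v = dot v u.
Proof. by rewrite !dotE; apply: eq_bigr => j _; rewrite mulrC. Qed.

Lemma dotDl u v w : dot (u + v) w = dot u w + dot v w.
Proof. by rewrite /dot mulmxDl mxE. Qed.

Lemma dotNl u w : dot (- u) w = - dot u w.
Proof. by rewrite /dot mulNmx mxE. Qed.

Lemma dotZl c u w : dot (c *: u) w = c * dot u w.
Proof. by rewrite /dot -scalemxAl mxE. Qed.

Lemma dotDr u v w : dot w (u + v) = dot w u + dot w v.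
Proof. by rewrite ![dot w _]dotC dotDl. Qed.

Lemma dotNr u w : dot w (- u) = - dot w u.
Proof. by rewrite ![dot w _]dotC dotNl. Qed.

Lemma dotZr c u w : dot w (c *: u) = c * dot w u.
Proof. by rewrite ![dot w _]dotC dotZl. Qed.

Lemma dot0l w : dot 0 w = 0.
Proof. by rewrite /dot mul0mx mxE. Qed.

Lemma dot0r w : dot w 0 = 0.
Proof. by rewrite dotC dot0l. Qed.

Lemma dot_sumr (T : Type) (s : seq T) (P : pred T) (F : T -> 'rV[R]_n) w :
  dot w (\sum_(i <- s | P i) F i) = \sum_(i <- s | P i) dot w (F i).
Proof.
elim/big_rec2: _ => [|i a b _ <-]; last by rewrite dotDr.
by rewrite dot0r.
Qed.

Lemma dot_ge0 u : 0 <= dot u u.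
Proof. by rewrite dotE sumr_ge0// => j _; rewrite -expr2 sqr_ge0. Qed.

Lemma dot_eq0 u : (dot u u == 0) = (u == 0).
Proof.
apply/idP/eqP => [|->]; last by rewrite dot0l.
rewrite dotE psumr_eq0; last by move=> j _; rewrite -expr2 sqr_ge0.
move=> /allP u0; apply/rowP => j; rewrite mxE.
by have := u0 j (mem_index_enum _); rewrite /= mulf_eq0 orbb => /eqP.
Qed.

Lemma dot_gt0 u : u != 0 -> 0 < dot u u.
Proof. by move=> u0; rewrite lt_neqAle dot_ge0 andbT eq_sym dot_eq0. Qed.

End Dot.

(* Locked: unification would otherwise compare floors of real numbers by
   unfolding them. *)
HB.lock Definition ubnd (R : realType) (n : nat) (x a : 'rV[R]_n) : int :=
  Num.floor (dot x a) + 1.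

(** * The integer k_a(x), coded as [ubnd x a], and its behaviour under sums *)

Section UpperBound.
Variables (R : realType) (n : nat).
Implicit Types (x a b : 'rV[R]_n).

Lemma ubnd_gt x a : dot x a < (ubnd x a)%:~R.
Proof. by rewrite ubnd.unlock floorD1_gt. Qed.

Lemma ubnd_ge x a : (ubnd x a)%:~R - 1 <= dot x a.
Proof. by rewrite ubnd.unlock intrD addrK floor_le. Qed.

Lemma ubnd_le x a (z : int) : dot x a < z%:~R -> ubnd x a <= z.
Proof. by rewrite -floor_lt_int ubnd.unlock lezD1. Qed.

Lemma ubnd_def x a (z : int) :
  z%:~R - 1 <= dot x a -> dot x a < z%:~R -> ubnd x a = z.
Proof.
move=> h1 h2; rewrite ubnd.unlock (@floor_def _ _ (z - 1)) ?subrK//.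
by rewrite intrB h1.
Qed.

Lemma ubndD x a b : ubnd x (a + b) <= ubnd x a + ubnd x b.
Proof.
by apply: ubnd_le; rewrite dotDr intrD ltrD// ubnd_gt.
Qed.

Lemma ubndD_ge x a b : ubnd x a + ubnd x b <= ubnd x (a + b) + 1.
Proof.
suff : ubnd x a + ubnd x b - 2 < ubnd x (a + b) by lia.
rewrite -(ltr_int R) intrB intrD; apply: le_lt_trans (ubnd_gt x _).
by rewrite dotDr; have := ubnd_ge x a; have := ubnd_ge x b; lra.
Qed.

End UpperBound.

(** * Differences of roots, and the walk towards a hyperplane *)

Section Roots.
Variables (R : realType) (n : nat).
Implicit Types (Phi Psi : seq 'rV[R]_n) (a b c : 'rV[R]_n).

(** These properties pass from [Phi] to the roots orthogonal to a given vector, which need not span;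
    the combinatorial part uses both sets. *)
Definition diff_closed Psi :=
  [/\ forall a, a \in Psi -> a != 0,
      forall a, a \in Psi -> - a \in Psi
    & forall a b, a \in Psi -> b \in Psi -> 0 < dot a b -> a != b ->
        a - b \in Psi].

(** Both Cartan integers of [a] and [b] are positive. If one is 1, a reflection yields [a - b] up to
    sign; if both are at least 2, then |a - b|^2 <= 0, against [a != b]. *)
Lemma crystallographic_diff_closed Phi :
  crystallographic_root_system Phi -> diff_closed Phi.
Proof.
case=> _ nz hrefl hred hint.
have hN a : a \in Phi -> - a \in Phi.
  move=> aP; have := hrefl a a aP aP.
  rewrite /refl mulfK ?dot_eq0 ?nz//.
  by rewrite scaler_nat mulr2n opprD addrA subrr sub0r.
split=> // a b aP bP ab neq.
have [a0 b0] := (dot_gt0 (nz _ aP), dot_gt0 (nz _ bP)).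
have [z hz] := hint b a bP aP.
have [z' hz'] := hint a b aP bP.
have hz2 : 2 * dot a b = z%:~R * dot b b by rewrite -hz mulfVK// gt_eqF.
have hz2' : 2 * dot a b = z'%:~R * dot a a.
  by rewrite -hz' mulfVK ?gt_eqF// dotC.
have [z1|z1] := leP z 1.
  have -> : a - b = refl b a; last exact: hrefl.
  rewrite /refl hz; suff -> : z = 1 by rewrite scale1r.
  have : 0 < z by rewrite -(ltr_int R) -hz divr_gt0// mulr_gt0.
  by lia.
have [z1'|z1'] := leP z' 1.
  have -> : a - b = - refl a b; last by apply/hN/hrefl.
  rewrite /refl hz'; suff -> : z' = 1 by rewrite scale1r opprB.
  have : 0 < z' by rewrite -(ltr_int R) -hz' divr_gt0// dotC mulr_gt0.
  by lia.
have h2 : 2 <= z%:~R :> R by rewrite (ler_int R 2 z); lia.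
have h2' : 2 <= z'%:~R :> R by rewrite (ler_int R 2 z'); lia.
have : dot (a - b) (a - b) <= 0.
  rewrite !dotDl !dotDr !dotNl !dotNr [dot b a]dotC; nra.
have := dot_ge0 (a - b) => h h'.
have : dot (a - b) (a - b) == 0 by rewrite eq_le h h'.
by rewrite dot_eq0 subr_eq0 (negbTE neq).
Qed.

Lemma diff_closed_orth Phi (v : 'rV[R]_n) :
  diff_closed Phi -> diff_closed [seq a <- Phi | dot v a == 0].
Proof.
case=> nz hN hB; split=> [a|a|a b].
- by rewrite mem_filter => /andP[_ /nz].
- by rewrite !mem_filter dotNr oppr_eq0 => /andP[-> /hN].
- rewrite !mem_filter => /andP[/eqP va aP] /andP[/eqP vb bP] ab neq.
  by rewrite dotDr dotNr va vb subrr eqxx hB.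
Qed.

(** Expanding |a + b|^2 = <a + b, c + d> > 0 shows that one of the four products is positive, and b
    - c = -(a - d), b - d = -(a - c). *)
Lemma diff_closed_quad Phi a b c d : diff_closed Phi ->
  a \in Phi -> b \in Phi -> c \in Phi -> d \in Phi -> a + b \in Phi ->
  a + b = c + d -> [\/ a = c, a = d, a - c \in Phi | a - d \in Phi].
Proof.
case=> nz hN hB aP bP cP dP abP e.
have := dot_gt0 (nz _ abP); rewrite {2}e dotDl !dotDr.
have [<-|ac] := eqVneq a c; first by constructor 1.
have [<-|ad] := eqVneq a d; first by constructor 2.
have hbc : b - c = - (a - d).
  by apply/eqP; rewrite opprB subr_eq addrAC [d + c]addrC -e [a + b]addrC addrK.
have hbd : b - d = - (a - c).
  by apply/eqP; rewrite opprB subr_eq addrAC -e [a + b]addrC addrK.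
have bc : b != c by rewrite -subr_eq0 hbc oppr_eq0 subr_eq0.
have bd : b != d by rewrite -subr_eq0 hbd oppr_eq0 subr_eq0.
have [h _|h1] := ltP 0 (dot a c); first by constructor 3; exact: hB.
have [h _|h2] := ltP 0 (dot a d); first by constructor 4; exact: hB.
have [h _|h3] := ltP 0 (dot b c).
  by constructor 4; rewrite -[a - d]opprK -hbc; apply/hN/hB.
have [h _|h4] := ltP 0 (dot b d).
  by constructor 3; rewrite -[a - c]opprK -hbd; apply/hN/hB.
by lra.
Qed.

Lemma seq_argmin (T : eqType) (s : seq T) (t : T -> R) (a : T) : a \in s ->
  exists2 b : T, b \in s & forall c : T, c \in s -> t b <= t c.
Proof.
elim: s a => // a0 s IH a _.
case: s IH => [_|a1 s IH].
  by exists a0; rewrite ?mem_seq1// => c; rewrite mem_seq1 => /eqP->.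
have [b bs hb] := IH a1 (mem_head _ _).
have [h|h] := leP (t a0) (t b).
  exists a0; rewrite ?mem_head// => c; rewrite in_cons => /predU1P[->//|/hb].
  exact: le_trans.
exists b; first by rewrite in_cons bs orbT.
by move=> c; rewrite in_cons => /predU1P[->|/hb//]; exact: ltW.
Qed.

(** Orthogonal projection of [x] onto the hyperplane <.,d> = k_d(x). *)
Definition foot (x d : 'rV[R]_n) : 'rV[R]_n :=
  x + (((ubnd x d)%:~R - dot x d) / dot d d) *: d.

(* Walking from [x] in the direction [d], the first hyperplane met is either
   the one bounding [d] or the one bounding another root [b]; in the latter
   case the affine root of [d] minus that of [b] is still positive at [x]. *)
Lemma foot_wall_or_split Psi (x d : 'rV[R]_n) : diff_closed Psi -> d \in Psi ->
  (forall b, b \in Psi -> forall z : int, dot x b <> z%:~R) ->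
  (forall b, b \in Psi -> b != d -> b != - d ->
     forall z : int, dot (foot x d) b <> z%:~R) ->
  (forall b, b \in Psi -> b != d -> b != - d ->
     ubnd (foot x d) b = ubnd x b) \/
  exists b e, [/\ b \in Psi, e \in Psi, d = b + e
                & ubnd x d = ubnd x b + ubnd x e].
Proof.
move=> [nz hN hB] dP hx hy.
have ubgt b : b \in Psi -> (ubnd x b)%:~R - 1 < dot x b.
  move=> bP; rewrite lt_neqAle ubnd_ge andbT; apply/eqP => h.
  by apply: (hx b bP (ubnd x b - 1)); rewrite intrB -h.
(* The time at which [x + t d] reaches <.,b> = k_b; only roots with <d,b> > 0 are approached. *)
pose t b := ((ubnd x b)%:~R - dot x b) / dot d b.
have dC : d \in [seq b <- Psi | 0 < dot d b].
  by rewrite mem_filter dP dot_gt0// nz.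
have [b] := seq_argmin t dC.
rewrite mem_filter => /andP[db bP] bmin.
have htb : t b * dot d b = (ubnd x b)%:~R - dot x b.
  by rewrite /t mulfVK// gt_eqF.
have dd := dot_gt0 (nz _ dP).
have htd : t d * dot d d = (ubnd x d)%:~R - dot x d.
  by rewrite /t mulfVK// gt_eqF.
have [ltd|led] := ltP (t b) (t d); [right|left].
  have neq : d != b by apply/eqP => h; move: ltd; rewrite h ltxx.
  have eP := hB _ _ dP bP db neq.
  exists b, (d - b); split => //; first by rewrite addrC subrK.
  have ltd' : t b * dot d d < (ubnd x d)%:~R - dot x d.
    by rewrite -htd ltr_pM2r.
  suff -> : ubnd x (d - b) = ubnd x d - ubnd x b by lia.
  apply: ubnd_def; rewrite intrB dotDr dotNr.
    by have := ubgt d dP; have := ubnd_gt x b; lra.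
  (* Otherwise [b - d] would have a positive product with [d] and be reached before [b], against the
     minimality of [t b]. *)
  rewrite ltNge; apply/negP => hj.
  have hj' : (ubnd x d)%:~R - (ubnd x b)%:~R < dot x d - dot x b.
    rewrite lt_neqAle hj andbT; apply/eqP => h.
    by apply: (hx _ eP (ubnd x d - ubnd x b)); rewrite intrB dotDr dotNr h.
  have de : t b * (dot d d - dot d b) <
      (ubnd x d)%:~R - (ubnd x b)%:~R - (dot x d - dot x b) by lra.
  have tb0 : 0 < t b.
    by rewrite /t divr_gt0// subr_gt0 ubnd_gt.
  have de0 : dot d d - dot d b < 0.
    rewrite ltNge; apply/negP => h.
    have : 0 <= t b * (dot d d - dot d b) by rewrite mulr_ge0// ltW.
    by lra.
  have NeC : - (d - b) \in [seq b <- Psi | 0 < dot d b].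
    by rewrite mem_filter hN// andbT dotNr dotDr dotNr; lra.
  have := bmin _ NeC; rewrite leNgt => /negP; apply.
  rewrite {1}/t ltr_pdivrMr; last by rewrite dotNr dotDr dotNr; lra.
  have : ubnd x (- (d - b)) <= - (ubnd x d - ubnd x b).
    by apply: ubnd_le; rewrite intrN intrB dotNr dotDr dotNr; lra.
  rewrite -(ler_int R) intrN intrB => hu.
  move: de; rewrite !dotNr !dotDr !dotNr; lra.
(* Roots with <d,c> <= 0 do not grow along the walk; the others reach their bound no earlier than
   [d], and genericity of the foot excludes a tie. *)
have half c : c \in Psi -> c != d -> c != - d ->
    dot (foot x d) c < (ubnd x c)%:~R.
  move=> cP cd cNd; have Hn := hy c cP cd cNd (ubnd x c).
  rewrite lt_neqAle; apply/andP; split; first exact/eqP.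
  rewrite /foot -/(t d) dotDl dotZl.
  have td0 : 0 < t d by rewrite /t divr_gt0// subr_gt0 ubnd_gt.
  have [dc|dc] := leP (dot d c) 0.
    have : t d * dot d c <= 0 by rewrite mulr_ge0_le0// ltW.
    by have := ubnd_gt x c; lra.
  have cC : c \in [seq b <- Psi | 0 < dot d b] by rewrite mem_filter cP dc.
  have : t d <= t c by apply: le_trans led (bmin _ cC).
  by rewrite {2}/t ler_pdivlMr//; lra.
move=> c cP cd cNd; apply: ubnd_def; last exact: half.
have hc : - c != d by rewrite eqr_oppLR.
have hc' : - c != - d by rewrite eqr_opp.
have := half _ (hN _ cP) hc hc'.
have : ubnd x (- c) <= 1 - ubnd x c.
  by apply: ubnd_le; rewrite dotNr intrB; have := ubgt c cP; lra.
by rewrite -(ler_int R) intrB dotNr; lra.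
Qed.

End Roots.

(** * Decompositions into elements of the ideals, read at one point [x] *)

Section Decompositions.
Variables (R : realType) (n : nat) (Phi : seq 'rV[R]_n) (x : 'rV[R]_n).
Variables (k : nat) (I : nat -> set 'rV[R]_n).
Hypothesis HPhi : diff_closed Phi.
Hypothesis hx0 : forall a, a \in Phi -> dot x a != 0.
Hypothesis HI : forall i a, I i a <->
  [/\ (0 < i <= k)%N, a \in Phi, 0 < dot x a & dot x a < i%:R].

Local Notation V := 'rV[R]_n.
Implicit Types (a b c d e v : V) (m t i j : nat).

(** Records the length [m.+1] of a decomposition, for induction on it. *)
Definition rdecomp_len m v t := exists s : seq (V * nat),
  [/\ size s = m.+1, (forall p, p \in s -> I p.2 p.1 /\ (0 < p.2 <= k)%N),
      \sum_(p <- s) p.1 = v & (\sum_(p <- s) p.2)%N = t].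

(** Any decomposition of [d] has total rank above <x,d>, hence at least k_d(x); here this lower
    bound is attained. *)
Definition tight d := exists2 t : nat, t%:Z = ubnd x d & rdecomp I k d t.

Lemma rdecomp_lenP v t : rdecomp I k v t <-> exists m, rdecomp_len m v t.
Proof.
split=> [[s [s0 h1 h2 h3]]|[m [s [hs h1 h2 h3]]]].
  by exists (size s).-1, s; split=> //; case: s s0 {h1 h2 h3}.
by exists s; split=> //; case: s hs {h1 h2 h3}.
Qed.

Lemma rdecomp_len_bound m v t : rdecomp_len m v t ->
  0 < dot x v /\ dot x v < t%:R.
Proof.
case=> s [hs h <- <-]; elim: s m hs h => // p s IH m _ h.
have [/HI[_ _ p0 p1] _] := h p (mem_head _ _).
rewrite !big_cons dotDr natrD.
case: s IH h => [_ _|q s IH h]; first by rewrite !big_nil dot0r addr0; lra.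
have [|] := IH (size s) erefl; last by lra.
by move=> q' hq; apply: h; rewrite in_cons hq orbT.
Qed.

Lemma rdecomp_bound v t : rdecomp I k v t -> 0 < dot x v /\ dot x v < t%:R.
Proof. by move=> /rdecomp_lenP[m /rdecomp_len_bound]. Qed.

Lemma rdecomp1 t v : I t v -> rdecomp I k v t.
Proof.
move=> h; exists [:: (v, t)]; split; rewrite ?big_seq1 // => p.
by rewrite mem_seq1 => /eqP->; split=> //; case/HI: h.
Qed.

Lemma rdecomp_len0 v t : rdecomp_len 0 v t -> I t v.
Proof.
case=> -[|p [|? ?]] [// _ h <- <-]; rewrite !big_seq1.
by case: (h p (mem_head _ _)).
Qed.

Lemma rdecompD a b t t' :
  rdecomp I k a t -> rdecomp I k b t' -> rdecomp I k (a + b) (t + t').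
Proof.
move=> [s [s0 h1 h2 h3]] [s' [s0' h1' h2' h3']]; exists (s ++ s').
rewrite !big_cat /= h2 h3 h2' h3'; split=> //; first by case: s s0 {h1 h2 h3}.
by move=> p; rewrite mem_cat => /orP[/h1|/h1'].
Qed.

(** Since <v,v> > 0 is the sum of the products of [v] with the terms, some term has a positive
    product with [v]. It differs from [v] because the remaining terms have a positive sum at [x]. *)
Lemma rdecomp_len_step m v t : rdecomp_len m.+1 v t -> v \in Phi ->
  exists a r t', [/\ I r a, v - a \in Phi, rdecomp_len m (v - a) t'
    & t = (t' + r)%N].
Proof.
move=> [s [hs h hv ht]] vP.
have [nz _ hB] := HPhi.
have [p ps hp] : exists2 p, p \in s & 0 < dot v p.1.
  apply: contrapT => hn; have := dot_gt0 (nz _ vP).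
  rewrite -{2}hv dot_sumr big_seq ltNge => /negP; apply.
  apply: sumr_le0 => p ps; rewrite leNgt; apply/negP => hp.
  by apply: hn; exists p.
have D : rdecomp_len m (v - p.1) (\sum_(q <- rem p s) q.2).
  exists (rem p s); split=> //.
  - by rewrite size_rem// hs.
  - by move=> q /mem_rem/h.
  - by rewrite -hv (perm_big _ (perm_to_rem ps)) big_cons/= [p.1 + _]addrC addrK.
have [/HI[_ pP _ _] pr] := h p ps.
exists p.1, p.2, (\sum_(q <- rem p s) q.2)%N; split=> //.
- by case: (h p ps).
- apply: hB => //; apply/eqP => e.
  have [] := rdecomp_len_bound D.
  by rewrite e subrr dot0r ltxx.
- by rewrite -ht (perm_big _ (perm_to_rem ps)) big_cons/= addnC.
Qed.

Lemma ubnd_le_nat a t : dot x a < t%:R -> ubnd x a <= t%:Z.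
Proof. by move=> h; apply: ubnd_le. Qed.

Lemma ubnd_pos a : 0 < dot x a -> 0 < ubnd x a.
Proof. by move=> h; rewrite -(ltr_int R); apply: lt_trans h (ubnd_gt _ _). Qed.

Lemma ubnd_homo a b : dot x a <= dot x b -> ubnd x a <= ubnd x b.
Proof. by move=> h; apply: ubnd_le; apply: le_lt_trans h (ubnd_gt _ _). Qed.

Lemma mem_ubnd d : d \in Phi -> 0 < dot x d -> ubnd x d <= k%:Z ->
  I `|ubnd x d|%N d.
Proof.
move=> dP d0 dk; have u0 := ubnd_pos d0.
have hu : (absz (ubnd x d))%:Z = ubnd x d by lia.
apply/HI; split=> //; first by lia.
by rewrite -[_%:R]/((Posz _)%:~R : R) hu ubnd_gt.
Qed.

Lemma tight_small d : d \in Phi -> 0 < dot x d -> ubnd x d <= k%:Z -> tight d.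
Proof.
move=> dP d0 dk; have u0 := ubnd_pos d0.
exists (absz (ubnd x d)); first by lia.
exact/rdecomp1/mem_ubnd.
Qed.

Lemma tightD a b : tight a -> tight b -> ubnd x (a + b) = ubnd x a + ubnd x b ->
  tight (a + b).
Proof.
move=> [t ht at_] [t' ht' bt] e; exists (t + t')%N; first by lia.
exact: rdecompD.
Qed.

Lemma root_sign a : a \in Phi -> 0 < dot x a \/ 0 < dot x (- a).
Proof.
move=> /hx0; rewrite dotNr oppr_gt0; case: ltgtP => // _; by [left|right].
Qed.

(* Splitting off the last term [a] of the decomposition gives roots
   [g = d + b = c + a] with [c] and [a] tight; if [d] is neither, it differs
   from one of them by a root, which transfers the tightness to [d]. *)
Lemma tight_summand m g d b t : g \in Phi -> d \in Phi -> b \in Phi ->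
  0 < dot x d -> 0 < dot x b -> g = d + b -> rdecomp_len m g t ->
  t%:Z = ubnd x g -> ubnd x d + ubnd x b = ubnd x g + 1 -> tight d.
Proof.
have [_ hN hB] := HPhi.
elim: m g d b t => [|m IH] g d b t gP dP bP d0 b0 hg D ht hu.
  have /HI[tk _ _ gt] := rdecomp_len0 D.
  apply: tight_small => //.
  have : ubnd x d <= ubnd x g by apply: ubnd_homo; rewrite hg dotDr; lra.
  by lia.
have [a [r [t' [Ia cP D' htt]]]] := rdecomp_len_step D gP.
set c := g - a in cP D'.
have hgc : d + b = c + a by rewrite -hg /c subrK.
clearbody c.
have [c0 ct] := rdecomp_len_bound D'.
have /HI[rk aP a0 ar] := Ia.
have uc := ubnd_le_nat ct; have ua := ubnd_le_nat ar.
have uca := ubndD x c a; rewrite -hgc -hg in uca.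
(* The chain k_g <= k_c + k_a <= t' + r = k_g forces equality throughout. *)
have hct : t'%:Z = ubnd x c by clear - ht htt uc ua uca; lia.
have har : r%:Z = ubnd x a by clear - ht htt uc ua uca; lia.
have {ht htt} hgca : ubnd x g = ubnd x c + ubnd x a.
  by clear - ht htt hct har; lia.
clear uc ua uca.
have tc : tight c by exists t' => //; apply/rdecomp_lenP; exists m.
have ta : tight a by exists r => //; exact: rdecomp1.
have dbP : d + b \in Phi by rewrite -hg.
case: (diff_closed_quad HPhi dP bP cP aP dbP hgc) => [->//|->//|eP|eP].
- have hd : d = c + (d - c) by rewrite addrC subrK.
  move: (d - c) eP hd => e eP hd.
  have he : a = b + e.
    by move: hgc; rewrite hd -addrA => /addrI <-; rewrite addrC.
  have da : dot x a = dot x b + dot x e by rewrite he dotDr.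
  have h1 := ubndD x c e; rewrite -hd in h1.
  have h2 := ubndD_ge x b e; rewrite -he in h2.
  case: (root_sign eP) => e0.
    have ue : ubnd x e <= ubnd x a by apply: ubnd_homo; lra.
    have te : tight e by apply: tight_small => //; clear - rk har ue; lia.
    have ud : ubnd x d = ubnd x c + ubnd x e by clear - h1 h2 hgca hu; lia.
    by rewrite hd; apply: tightD; rewrite -?hd.
  (* Now [- e] is positive, so [d] is a summand of [c], whose decomposition is shorter. *)
  have hc : c = d + - e by rewrite hd addrK.
  have hb : b = a + - e by rewrite he addrK.
  apply: (IH c d (- e) t') => //; first exact: hN.
  have h3 := ubndD x a (- e); rewrite -hb in h3.
  have h4 := ubndD_ge x d (- e); rewrite -hc in h4.
  clear - h3 h4 hgca hu; lia.
- have hd : d = a + (d - a) by rewrite addrC subrK.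
  move: (d - a) eP hd => e eP hd.
  have he : c = b + e.
    by move: hgc; rewrite hd -addrA [c + a]addrC => /addrI <-; rewrite addrC.
  have h1 := ubndD x a e; rewrite -hd in h1.
  have h2 := ubndD_ge x b e; rewrite -he in h2.
  have da : dot x d = dot x a + dot x e by rewrite hd dotDr.
  case: (root_sign eP) => e0.
    have [ue uc] : ubnd x e + ubnd x b = ubnd x c + 1 /\
        ubnd x d = ubnd x a + ubnd x e.
      by clear - h1 h2 hgca hu; lia.
    have te : tight e by apply: (IH c e b t') => //; rewrite addrC.
    by rewrite hd; apply: tightD; rewrite -?hd.
  apply: tight_small => //.
  have : ubnd x d <= ubnd x a.
    by apply: ubnd_homo; move: e0; rewrite dotNr; lra.
  by clear - har rk; lia.
Qed.

(** * Consequences of indecomposability of [a] for sums of roots *)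

Section Indecomposable.
Variables (a : V) (r : nat).
Hypothesis Ia : I r a.
Hypothesis amin : forall t, rdecomp I k a t -> (r <= t)%N.
Hypothesis aind : forall i j, (i + j)%N = r ->
  ~ exists b c, [/\ I i b, I j c & a = b + c].
Hypothesis asum : forall b t, b \in Phi -> 0 < dot x b -> a + b \in Phi ->
  0 < dot x (a + b) -> rank_eq I k (a + b) t -> (t <= k)%N -> I (t - r)%N b.

Let akP : [/\ (0 < r <= k)%N, a \in Phi & 0 < dot x a].
Proof. by case/HI: Ia. Qed.

(** A smaller value would put [c] in I_{r-i}, and [a = b + c] would violate condition (ii). *)
Lemma indecomposable_compl i b c : I i b -> c \in Phi -> 0 < dot x c ->
  a = b + c -> r%:R - i%:R <= dot x c.
Proof.
move=> Ib cP c0 e; have /HI[ik _ _ _] := Ib; have [rk _ _] := akP.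
have [ri|ir] := leqP r i.
  by have : r%:R <= i%:R :> R; [rewrite ler_nat|lra].
rewrite leNgt; apply/negP => h.
apply: (aind (subnKC (ltnW ir))); exists b, c; split=> //; apply/HI.
by split=> //; [lia|rewrite natrB// ltnW].
Qed.

(** Condition (iii), applied at the actual rank [t0] of [a + b], which is at most [t]. *)
Lemma indecomposable_sum1 b t : I t (a + b) -> b \in Phi -> 0 < dot x b ->
  dot x b < t%:R - r%:R.
Proof.
move=> Iab bP b0; have /HI[tk abP ab0 _] := Iab.
have ex : exists t', `[< rdecomp I k (a + b) t' >].
  by exists t; apply/asboolP/rdecomp1.
have [t0 /asboolP h1 h2] := ex_minnP ex.
have t0t : (t0 <= t)%N by apply/h2/asboolP/rdecomp1.
have h : rank_eq I k (a + b) t0.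
  by split=> // t' h'; apply/h2/asboolP.
have t0k : (t0 <= k)%N by lia.
have /HI[tr _ _] := asum bP b0 abP ab0 h t0k.
(* Membership in an ideal forces t0 - r > 0, so the truncated subtraction is exact. *)
rewrite natrB; last by lia.
by move=> hb; have : t0%:R <= t%:R :> R; [rewrite ler_nat|lra].
Qed.

(** Induction on the length carries condition (iii) to decompositions of any total rank. Peeling off
    [d] gives a + b = c + d. If [a] is one of these parts, minimality of [r] applies. Otherwise [a]
    differs from a part by a root [e]: a positive [e] goes to [indecomposable_compl] or to r <= t',
    and for a negative one that part is a + (- e), a shorter instance. *)
Lemma indecomposable_sum m b t : a + b \in Phi -> b \in Phi -> 0 < dot x b ->
  rdecomp_len m (a + b) t -> dot x b < t%:R - r%:R.
Proof.
have [_ hN hB] := HPhi; have [rk aP a0] := akP.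
elim: m b t => [|m IH] b t gP bP b0 D.
  by apply: indecomposable_sum1 => //; exact: rdecomp_len0.
have [d [j [t' [Id cP D' ->]]]] := rdecomp_len_step D gP.
set c := a + b - d in cP D'.
have hgc : a + b = c + d by rewrite /c subrK.
clearbody c.
have [c0 ct] := rdecomp_len_bound D'.
have /HI[jk dP d0 dj] := Id.
rewrite natrD.
case: (diff_closed_quad HPhi aP bP cP dP gP hgc) => [e|e|eP|eP].
- have hb : b = d by move: hgc; rewrite e => /addrI.
  have : (r <= t')%N by apply: amin; rewrite e; apply/rdecomp_lenP; exists m.
  by rewrite -(ler_nat R) hb; lra.
- have hb : b = c by move: hgc; rewrite -e [c + a]addrC => /addrI.
  have : (r <= j)%N by apply: amin; rewrite e; apply: rdecomp1.
  by rewrite -(ler_nat R) hb; lra.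
- have ha : a = c + (a - c) by rewrite addrC subrK.
  move: (a - c) eP ha => e eP ha.
  have hd : d = b + e.
    by move: hgc; rewrite ha -addrA => /addrI <-; rewrite addrC.
  have dd : dot x d = dot x b + dot x e by rewrite hd dotDr.
  case: (root_sign eP) => e0.
    have [tr|tr] := leqP r t'.
      by move: tr; rewrite -(ler_nat R); lra.
    have Ic : I t' c.
      apply/HI; split=> //; have : 0 < t'%:R :> R by lra.
      by rewrite ltr0n => t0; clear - t0 tr rk; lia.
    by have := indecomposable_compl Ic eP e0 ha; lra.
  have hc : c = a + - e by rewrite ha addrK.
  have := IH (- e) t'; rewrite -hc => /(_ cP (hN _ eP) e0 D').
  by rewrite dotNr; lra.
- have ha : a = d + (a - d) by rewrite addrC subrK.
  move: (a - d) eP ha => e eP ha.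
  have hc : c = b + e.
    by move: hgc; rewrite ha -addrA [c + d]addrC => /addrI <-; rewrite addrC.
  have dc : dot x c = dot x b + dot x e by rewrite hc dotDr.
  case: (root_sign eP) => e0.
    by have := indecomposable_compl Id eP e0 ha; lra.
  have hd : d = a + - e by rewrite ha addrK.
  have Id' : I j (a + - e) by rewrite -hd.
  by have := indecomposable_sum1 Id' (hN _ eP) e0; rewrite dotNr; lra.
Qed.

End Indecomposable.

(** * Consequences of the maximal choice of [x] *)

Section Maximal.
Variable Psi : seq V.
Hypothesis HPsi : diff_closed Psi.
Hypothesis PsiPhi : {subset Psi <= Phi}.
Hypothesis hx : forall b, b \in Psi -> forall z : int, dot x b <> z%:~R.
Hypothesis hy : forall d, d \in Psi -> forall b, b \in Psi -> b != d ->
  b != - d -> forall z : int, dot (foot x d) b <> z%:~R.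
(** The form in which maximality of [x] enters. *)
Hypothesis hwall : forall d, d \in Psi -> 0 < dot x d ->
  (forall b, b \in Psi -> b != d -> b != - d ->
    ubnd (foot x d) b = ubnd x b) -> ubnd x d <= k%:Z.

Lemma ubndN b : b \in Psi -> ubnd x (- b) = 1 - ubnd x b.
Proof.
move=> bP; have h : (ubnd x b)%:~R - 1 < dot x b.
  rewrite lt_neqAle ubnd_ge andbT; apply/eqP => h.
  by apply: (hx bP (z := ubnd x b - 1)); rewrite intrB -h.
by apply: ubnd_def; rewrite dotNr intrB; have := ubnd_gt x b; lra.
Qed.

(** The induction measure [N] counts the roots with smaller [f]. A split d = b + e gives f d = f b +
    f e with both terms positive, so both counts drop. *)
Lemma all_tight d : d \in Psi -> 0 < dot x d -> tight d.
Proof.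
pose f b : R := (ubnd x b)%:~R - dot x b.
have fgt b : 0 < f b by rewrite subr_gt0 ubnd_gt.
pose N b := count (fun c => f c < f b) Psi.
have NltN b c : b \in Psi -> f b < f c -> (N b < N c)%N.
  move=> bP bc; rewrite /N.
  apply: (@leq_trans (count (predU (fun e => f e < f b) (pred1 b)) Psi)).
    rewrite -[X in (_ < X)%N](addn0) -[X in (_ < _ + X)%N](count_pred0 Psi).
    rewrite -(@eq_count _ (predI (fun e => f e < f b) (pred1 b)) pred0).
      by rewrite count_predUI -addn1 leq_add2l -has_count has_pred1.
    by move=> e /=; case: (eqVneq e b) => [->|_]; rewrite ?ltxx ?andbF.
  apply: sub_count => e /= /orP[h|/eqP->//]; exact: lt_trans h bc.
have [M] := ubnP (N d); elim: M d => // M IH d; rewrite ltnS => NM dP d0.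
have [|[b [e [bP eP hd hu]]]] := foot_wall_or_split HPsi dP hx (hy dP).
  by move=> /(hwall dP d0) dk; apply: tight_small => //; exact: PsiPhi.
have [_ hN _] := HPsi.
have fd : f d = f b + f e by rewrite /f hu hd intrD dotDr; ring.
have Nb : (N b < M)%N by apply: leq_trans NM; apply: NltN => //; rewrite fd ltrDl.
have Ne : (N e < M)%N by apply: leq_trans NM; apply: NltN => //; rewrite fd ltrDr.
have dd : dot x d = dot x b + dot x e by rewrite hd dotDr.
(* If [b'] is negative, e' = d + (- b') is tight by induction, and k_d + k_{-b'} = k_{e'} + 1 lets
   [tight_summand] pass to [d]. *)
have tsum b' e' : b' \in Psi -> e' \in Psi -> d = b' + e' ->
    ubnd x d = ubnd x b' + ubnd x e' -> (N e' < M)%N ->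
    0 < dot x (- b') -> tight d.
  move=> bP' eP' hd' hu' Ne' b0; have he : e' = d + - b' by rewrite hd' addrC addKr.
  have e0 : 0 < dot x e' by rewrite he dotDr; lra.
  have [t ht /rdecomp_lenP[m D]] := IH e' Ne' eP' e0.
  apply: (tight_summand _ _ _ d0 b0 he D ht); try exact/PsiPhi.
    by apply/PsiPhi/hN.
  by rewrite ubndN//; clear - hu'; lia.
case: (root_sign (PsiPhi bP)) => b0; last exact: (tsum b e).
case: (root_sign (PsiPhi eP)) => e0; last by apply: (tsum e b); rewrite // addrC.
by rewrite hd; apply: tightD; [exact: IH|exact: IH|rewrite -hd].
Qed.

(** Tightness and minimality give k_a = r. A split a = b + e into positive roots contradicts (ii).
    If [b] is negative, [e] is tight and [indecomposable_sum] gives k_{-b} <= k_e - r = - k_b,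
    against k_{-b} = 1 - k_b. *)
Lemma indecomposable_wall a r : a \in Psi -> I r a ->
  (forall t, rdecomp I k a t -> (r <= t)%N) ->
  (forall i j, (i + j)%N = r -> ~ exists b c, [/\ I i b, I j c & a = b + c]) ->
  (forall b t, b \in Phi -> 0 < dot x b -> a + b \in Phi ->
    0 < dot x (a + b) -> rank_eq I k (a + b) t -> (t <= k)%N -> I (t - r)%N b) ->
  ubnd x a = r%:Z /\
  (forall b, b \in Psi -> b != a -> b != - a -> ubnd (foot x a) b = ubnd x b).
Proof.
move=> aPsi Ia amin aind asum; have /HI[rk aP a0 ar] := Ia.
have [_ hN _] := HPsi.
have ur : ubnd x a = r%:Z.
  have [t ht /amin] := all_tight aPsi a0.
  by have := ubnd_le_nat ar; lia.
split=> //.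
have [//|[b [e [bP eP hd hu]]]] := foot_wall_or_split HPsi aPsi hx (hy aPsi).
have neg b' e' : b' \in Psi -> e' \in Psi -> a = b' + e' ->
    ubnd x a = ubnd x b' + ubnd x e' -> 0 < dot x (- b') -> False.
  move=> bP' eP' hd' hu' b0.
  have he : e' = a + - b' by rewrite hd' addrC addKr.
  have e0 : 0 < dot x e' by rewrite he dotDr; lra.
  have [t ht /rdecomp_lenP[m D]] := all_tight eP' e0.
  have := @indecomposable_sum _ _ Ia amin aind asum m (- b') t.
  rewrite -he => /(_ (PsiPhi eP') (PsiPhi (hN _ bP')) b0 D) h.
  have : ubnd x (- b') <= t%:Z - r%:Z by apply: ubnd_le; rewrite intrB.
  by rewrite ubndN//; clear - ht hu' ur; lia.
exfalso.
case: (root_sign (PsiPhi bP)) => b0; last exact: (neg b e).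
case: (root_sign (PsiPhi eP)) => e0; last by apply: (neg e b); rewrite // addrC.
have ub := ubnd_pos b0; have ue := ubnd_pos e0.
have aindbe : (`|ubnd x b| + `|ubnd x e|)%N = r by clear - ub ue hu ur; lia.
apply: (aind _ _ aindbe).
have [ubk uek] : ubnd x b <= k%:Z /\ ubnd x e <= k%:Z.
  by clear - ub ue hu ur rk; lia.
by exists b, e; split=> //; apply: mem_ubnd => //; exact: PsiPhi.
Qed.

End Maximal.
End Decompositions.

(** * Neighbourhoods, connected components and generic points *)

Section Topology.
Variables (R : realType) (n : nat).
Local Notation V := 'rV[R]_n.
Implicit Types (x y u v w a b : V) (A : set (set V)) (c : R).

Lemma dot_continuous a : continuous (fun x => dot x a).
Proof.
have -> : (fun x => dot x a) = (fun x => \sum_j x 0 j * a 0 j).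
  by apply/funext => x; rewrite dotE.
move=> x; apply: (@cvg_big R^o 'I_n +%R 0 xpredT _ _ (nbhs x)) => [|j _].
  exact: add_continuous.
by apply: cvgMr_tmp; exact: coord_continuous.
Qed.

Lemma near_dot_lt x a c : dot x a < c -> \forall y \near x, dot y a < c.
Proof. by move=> h; apply: (cvgr_lt _ (@dot_continuous a x)). Qed.

Lemma near_dot_gt x a c : c < dot x a -> \forall y \near x, c < dot y a.
Proof. by move=> h; apply: (cvgr_gt _ (@dot_continuous a x)). Qed.

Lemma near_all_seq (T : eqType) (s : seq T) (P : T -> V -> Prop) x :
  (forall t, t \in s -> \forall y \near x, P t y) ->
  \forall y \near x, forall t, t \in s -> P t y.
Proof.
elim: s => [_|t s IH h]; first by near=> y.
have h1 : \forall y \near x, P t y by apply: h; rewrite mem_head.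
have h2 : \forall y \near x, forall t, t \in s -> P t y.
  by apply: IH => t' ts; apply: h; rewrite in_cons ts orbT.
near=> y => t'; rewrite in_cons => /predU1P[->|]; first by near: y.
by move: t'; near: y.
Unshelve. all: by end_near.
Qed.

Lemma near_line x v (P : V -> Prop) : (\forall y \near x, P y) ->
  exists2 e : R, 0 < e & forall s, `|s| < e -> P (x + s *: v).
Proof.
move=> Px.
have : (x + s *: v) @[s --> (0 : R)] --> x + 0 *: v.
  by apply: cvgD; [exact: cvg_cst | exact: scalel_continuous].
rewrite scale0r addr0 => /(_ _ Px) /nbhs_ballP[e e0 he].
exists e => // s se; apply: he.
by rewrite /ball/= sub0r normrN.
Qed.

Lemma closure_line (E : set V) x v :
  (forall e : R, 0 < e -> exists2 s, `|s| < e & E (x + s *: v)) -> closure E x.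
Proof.
move=> h B /(near_line v)[e e0 he]; have [s se sE] := h e e0.
by exists (x + s *: v); split=> //; exact: he.
Qed.

Lemma closure_dot_le (E : set V) a c x : (forall y, E y -> dot y a <= c) ->
  closure E x -> dot x a <= c.
Proof.
move=> h cx; rewrite leNgt; apply/negP => /near_dot_gt/cx[y [/h]].
by rewrite leNgt => /negP.
Qed.

Lemma component_side A x y a c : A (hyp a c) ->
  connected_component (arr_complement A) x y -> dot x a < c -> dot y a < c.
Proof.
move=> Aac xy xc.
have ne z : connected_component (arr_complement A) x z -> dot z a <> c.
  by move=> /connected_component_sub/(_ _ Aac).
have xx : connected_component (arr_complement A) x x.
  apply: connected_component_refl.
  exact: connected_component_sub (connected_component_sym xy).
rewrite ltNge; apply/negP => cy.
have /connected_intervalP itv : connected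
    ((fun z => dot z a) @` connected_component (arr_complement A) x).
  apply: connected_continuous_connected; first exact: component_connected.
  exact/continuous_subspaceT/dot_continuous.
have xcy : dot x a <= c <= dot y a by rewrite (ltW xc) cy.
have [z cz] := itv _ _ (ex_intro2 _ _ x xx erefl) (ex_intro2 _ _ y xy erefl) _ xcy.
exact: ne.
Qed.

Lemma segment_lt (p q c t : R) : 0 <= t -> t <= 1 -> p < c -> q < c ->
  p + t * (q - p) < c.
Proof.
move=> t0; rewrite le_eqVlt => /predU1P[->|t1] pc qc; first by lra.
have h1 : 0 < (1 - t) * (c - p) by rewrite mulr_gt0 ?subr_gt0.
have h2 : 0 <= t * (c - q) by rewrite mulr_ge0 ?subr_ge0// ltW.
by lra.
Qed.

(** A linear form maps a component onto an interval missing [c], so its side is constant;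
    conversely, the segment between two points on the same sides avoids every hyperplane. *)
Lemma componentP A (P : V -> R -> Prop) x y :
  (forall H, A H <-> exists a c, P a c /\ H = hyp a c) ->
  arr_complement A x ->
  connected_component (arr_complement A) x y <->
  (forall a c, P a c -> dot y a <> c /\ (dot x a < c) = (dot y a < c)).
Proof.
move=> hA Ax.
have PA a c : P a c -> A (hyp a c) by move=> Pac; apply/hA; exists a, c.
split=> [xy a c /PA Aac|side].
  have Ay : arr_complement A y by exact: connected_component_sub xy.
  split; first exact: (Ay _ Aac).
  apply/idP/idP; first exact: component_side xy.
  exact: component_side (connected_component_sym xy).
have cS : connected ((fun t => x + t *: (y - x)) @` `[0 : R, 1]).
  apply: connected_continuous_connected; first exact: segment_connected.
  apply: continuous_subspaceT => t; apply: cvgD; first exact: cvg_cst.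
  exact: scalel_continuous.
apply: (connected_component_max _ _ cS).
- by exists 0; rewrite ?scale0r ?addr0// /= in_itv/= lexx ler01.
- move=> _ [t tI <-] H AH.
  move: tI; rewrite /= in_itv/= => /andP[t0 t1].
  have /hA[a [c [Pac Hac]]] := AH; rewrite Hac in AH *.
  have [ny] := side a c Pac; have := Ax _ AH.
  rewrite /hyp/= dotDl dotZl dotDl dotNl => nx.
  have [xc|xc] := ltP (dot x a) c => /esym yc e.
    by have := segment_lt t0 t1 xc yc; rewrite e ltxx.
  have cx : c < dot x a by rewrite lt_neqAle xc andbT; apply/eqP => /esym.
  have cy : c < dot y a.
    by rewrite lt_neqAle leNgt yc andbT; apply/eqP => /esym.
  have cx' : - dot x a < - c by rewrite ltrN2.
  have cy' : - dot y a < - c by rewrite ltrN2.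
  by have := segment_lt t0 t1 cx' cy'; rewrite -e; lra.
- exists 1; first by rewrite /= in_itv/= lexx ler01.
  by rewrite scale1r addrC subrK.
Qed.

Lemma between_nonint (m z : int) c :
  m%:~R - 1 < c -> c < m%:~R -> c <> z%:~R.
Proof.
move=> h1 h2 h; move: h1 h2; rewrite h ltr_int -(intrB R m 1) ltr_int.
by move=> h1 h2; lia.
Qed.

(** One vector at a time: a small move along [u] makes <.,u> nonintegral, and lying strictly between
    two consecutive integers is an open condition added to [U]. *)
Lemma generic_point (U : V -> Prop) (s : seq V) x :
  (forall y, U y -> \forall z \near y, U z) -> U x ->
  (forall u, u \in s -> u != 0) ->
  exists2 y, U y & forall u, u \in s -> forall z : int, dot y u <> z%:~R.
Proof.
elim: s U x => [|u s IH] U x oU Ux snz; first by exists x.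
pose U' y := U y /\ exists m : int, m%:~R - 1 < dot y u < m%:~R.
have oU' y : U' y -> \forall z \near y, U' z.
  move=> [Uy [m /andP[h1 h2]]].
  have h1' := near_dot_gt h1; have h2' := near_dot_lt h2.
  have hU := oU _ Uy.
  near=> z; split; first by near: z.
  by exists m; apply/andP; split; near: z.
have [y U'y] : exists y, U' y.
  have u0 : 0 < dot u u by rewrite dot_gt0// snz// mem_head.
  have [e e0 he] := near_line u (oU _ Ux).
  pose m := Num.floor (dot x u) + 1.
  have xm : dot x u < m%:~R by exact: floorD1_gt.
  have mx : m%:~R - 1 <= dot x u by rewrite /m intrD addrK floor_le.
  (* Small enough to stay in [U] and to cover at most half the distance to the next integer. *)
  pose d := Num.min (e / 2) ((m%:~R - dot x u) / 2 / dot u u).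
  have d0 : 0 < d.
    by rewrite lt_min !divr_gt0// subr_gt0.
  have de : d <= e / 2 by rewrite ge_min lexx.
  have du : d * dot u u <= (m%:~R - dot x u) / 2.
    by rewrite -ler_pdivlMr// ge_min lexx orbT.
  have du0 : 0 < d * dot u u by exact: mulr_gt0.
  exists (x + d *: u); split; first by apply: he; rewrite gtr0_norm//; lra.
  by exists m; rewrite dotDl dotZl; apply/andP; split; lra.
have [|z [Uz [m /andP[m1 m2]]] hz] := IH U' y oU' U'y.
  by move=> w ws; apply: snz; rewrite in_cons ws orbT.
exists z => // w; rewrite in_cons => /predU1P[->|]; last exact: hz.
by move=> z'; exact: between_nonint m1 m2.
Unshelve. all: by end_near.
Qed.

(** The matrix with rows [S] is row free; the columns of a right inverse are dual to [S]. *)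
Lemma dual_vector (S : seq V) (f : 'I_(size S) -> R) : lin_indep S ->
  exists v, forall i : 'I_(size S), dot v S`_i = f i.
Proof.
move=> li; pose M := \matrix_(i < size S, j < n) (S`_i) 0 j.
have : row_free M.
  apply: inj_row_free => u uM; apply/rowP => i; rewrite mxE.
  apply: (li (fun i => u 0 i)); rewrite -[RHS]uM; apply/rowP => j.
  rewrite summxE mxE; apply: eq_bigr => l _; by rewrite !mxE.
move=> /row_freeP[B MB]; exists (B *m \col_i f i)^T => i.
rewrite dotC /dot trmxK mulmxA.
have -> : S`_i *m B = row i (M *m B).
  rewrite row_mul; congr (_ *m _).
  by apply/rowP => j; rewrite !mxE.
by rewrite MB row1 -rowE !mxE.
Qed.

Lemma large_multiple (T : eqType) (s : seq T) (c d : T -> R) :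
  exists2 L, 0 <= L & forall t, t \in s -> 0 < c t -> d t <= L * c t.
Proof.
elim: s => [|t s [L L0 IH]]; first by exists 0.
exists (Num.max L (d t / c t)); first by rewrite le_max L0.
move=> t'; rewrite in_cons => /predU1P[-> c0|ts c0].
  by rewrite -ler_pdivrMr// le_max lexx orbT.
by apply: le_trans (IH t' ts c0) _; rewrite ler_pM2r// le_max lexx.
Qed.

(** Moving along the component [u] of [b] orthogonal to [a] keeps <.,a> fixed, so <u,b> = <u,u>
    vanishes. *)
Lemma perp_const x a b c : a != 0 ->
  (\forall y \near x, dot y a = dot x a -> dot y b = c) ->
  exists q, b = q *: a.
Proof.
move=> a0 h; have aa := dot_gt0 a0.
pose u := b - (dot b a / dot a a) *: a.
have ua : dot u a = 0 by rewrite /u dotDl dotNl dotZl mulfVK ?subrr ?gt_eqF.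
have [e e0 he] := near_line u h.
have h0 : dot x b = c.
  by rewrite -[x]addr0 -(scale0r u); apply: he; rewrite ?normr0// scale0r addr0.
have e2 : 0 < e / 2 by rewrite divr_gt0.
have := he (e / 2); rewrite gtr0_norm// !dotDl !dotZl ua mulr0 addr0 h0.
move=> /(_ _ erefl) h1.
have {h1} ub : dot u b = 0.
  have h2 : e / 2 < e by lra.
  have := h1 h2 => h3.
  have : (e / 2) * dot u b = 0 by lra.
  by move=> /eqP; rewrite mulf_eq0 (gt_eqF e2) /= => /eqP.
have : dot u u == 0.
  by rewrite {2}/u dotDr dotNr dotZr ua ub mulr0 subrr.
rewrite dot_eq0 subr_eq0 => /eqP ->.
by exists (dot b a / dot a a).
Qed.

Lemma int_max (T : Type) (P : T -> Prop) (f : T -> int) (M : int) (t0 : T) :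
  P t0 -> (forall t, P t -> 0 <= f t <= M) ->
  exists2 t, P t & forall t', P t' -> f t' <= f t.
Proof.
move=> Pt0 h.
have ex : exists i, `[< exists2 t, P t & f t = i%:Z >].
  exists `|f t0|%N; apply/asboolP; exists t0 => //.
  by have := h _ Pt0; lia.
have ub i : `[< exists2 t, P t & f t = i%:Z >] -> (i <= `|M|)%N.
  by move=> /asboolP[t /h + e]; rewrite e; lia.
have [i /asboolP[t Pt ft] imax] := ex_maxnP ex ub.
exists t => // t' Pt'.
have := imax `|f t'|%N; have := h _ Pt'; rewrite ft => h1 h2.
suff : (`|f t'| <= i)%N by lia.
by apply: h2; apply/asboolP; exists t' => //; lia.
Qed.

Lemma ltr_sum_seq (T : eqType) (s : seq T) (F G : T -> int) t :
  t \in s -> (forall t', t' \in s -> F t' <= G t') -> F t < G t ->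
  \sum_(t' <- s) F t' < \sum_(t' <- s) G t'.
Proof.
move=> ts h ht; rewrite !(perm_big _ (perm_to_rem ts)) !big_cons/=.
apply: ltr_leD => //; rewrite big_seq [leRHS]big_seq.
by apply: ler_sum => t' /mem_rem/h.
Qed.

End Topology.

(** * Alcoves and ceilings expressed by inequalities *)

Section Alcoves.
Variables (R : realType) (n : nat) (Phi : seq 'rV[R]_n).
Local Notation V := 'rV[R]_n.
Implicit Types (x y z w a b : V) (A : set (set V)) (B : set V) (r : nat).

Lemma alcoveP x y : arr_complement (affine_arr Phi) x ->
  connected_component (arr_complement (affine_arr Phi)) x y <->
  (forall a (m : int), a \in Phi ->
    dot y a <> m%:~R /\ (dot x a < m%:~R) = (dot y a < m%:~R)).
Proof.
move=> Ax; pose P a c := a \in Phi /\ exists m : int, c = m%:~R :> R.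
have hP H : affine_arr Phi H <-> exists a c, P a c /\ H = hyp a c.
  split=> [[a [m [aP ->]]]|[a [c [[aP [m ->]] ->]]]].
    by exists a, m%:~R; split=> //; split=> //; exists m.
  by exists a, m.
rewrite (componentP _ hP Ax); split=> h a c; last by case=> aP [m ->]; exact: h.
by move=> aP; apply: h; split=> //; exists c.
Qed.

Lemma catalanP k x y : arr_complement (catalan_arr Phi k) x ->
  connected_component (arr_complement (catalan_arr Phi k)) x y <->
  (forall a r, a \in Phi -> (r <= k)%N ->
    dot y a <> r%:R /\ (dot x a < r%:R) = (dot y a < r%:R)).
Proof.
move=> Ax; pose P a c := a \in Phi /\ exists r, (r <= k)%N /\ c = r%:R :> R.
have hP H : catalan_arr Phi k H <-> exists a c, P a c /\ H = hyp a c.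
  split=> [[a [r [aP rk ->]]]|[a [c [[aP [r [rk ->]]] ->]]]].
    by exists a, r%:R; split=> //; split=> //; exists r.
  by exists a, r.
rewrite (componentP _ hP Ax); split=> h a c.
  by move=> aP ck; apply: h; split=> //; exists c.
by case=> aP [r [rk ->]]; exact: h.
Qed.

Lemma ubnd_ltE x a (m : int) : (dot x a < m%:~R) = (ubnd x a <= m).
Proof.
apply/idP/idP; first exact: ubnd_le.
by rewrite -(ler_int R); apply: lt_le_trans (ubnd_gt _ _).
Qed.

Lemma alcove_ubnd x y :
  (forall a, a \in Phi -> (ubnd x a)%:~R - 1 < dot x a) ->
  (forall a, a \in Phi -> (ubnd y a)%:~R - 1 < dot y a) ->
  (forall a, a \in Phi -> ubnd x a = ubnd y a) ->
  connected_component (arr_complement (affine_arr Phi)) x y.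
Proof.
move=> hx hy e; apply/alcoveP.
  move=> _ [a [m [aP ->]]]; exact: between_nonint (hx _ aP) (ubnd_gt _ _).
move=> a m aP; split; last by rewrite !ubnd_ltE e.
exact: between_nonint (hy _ aP) (ubnd_gt _ _).
Qed.

(** Otherwise scaling [x] by r / <x,a>, a factor in [0,1], would land on the hyperplane. *)
Lemma ceiling_lt A B a r x : (0 < r)%N -> ceiling A B (hyp a r%:R) -> B x ->
  dot x a < r%:R.
Proof.
move=> r0 [_ _ h] Bx; have rR : 0 < r%:R :> R by rewrite ltr0n.
rewrite ltNge; apply/negP => rx.
have x0 : 0 < dot x a by exact: lt_le_trans rx.
apply: (h x (r%:R / dot x a) Bx); last by rewrite /hyp/= dotZl mulfVK// gt_eqF.
by apply/andP; split; [rewrite divr_ge0// ltW|rewrite ler_pdivrMr// mul1r].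
Qed.

Lemma lt_ceiling A B a r : (0 < r)%N -> wall A B (hyp a r%:R) ->
  (forall x, B x -> dot x a < r%:R) -> ceiling A B (hyp a r%:R).
Proof.
move=> r0 wB h; have rR : 0 < r%:R :> R by rewrite ltr0n.
split=> //; first by rewrite /hyp/= dot0l => /esym/eqP; rewrite gt_eqF.
move=> x t /h xr /andP[t0 t1]; rewrite /hyp/= dotZl => e.
have [x0|x0] := leP (dot x a) 0.
  by have := mulr_ge0_le0 t0 x0; rewrite e; lra.
have : t * dot x a <= dot x a by rewrite ger_pMl.
by rewrite e; lra.
Qed.

(* Near a point lying on the hyperplane [dot _ a = r] and on no other
   non-parallel hyperplane, the side containing the origin is a single
   alcove. *)
Lemma alcove_below a r y : diff_closed Phi -> a \in Phi -> (0 < r)%N ->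
  dot y a = r%:R ->
  (forall b, b \in Phi -> b != a -> b != - a ->
    forall m : int, dot y b <> m%:~R) ->
  forall P : V -> Prop, (\forall z \near y, P z) ->
  exists z, [/\ P z, arr_complement (affine_arr Phi) z,
    ubnd z a = r%:Z,
    (forall b, b \in Phi -> b != a -> b != - a -> ubnd z b = ubnd y b) &
    ceiling (affine_arr Phi)
      (connected_component (arr_complement (affine_arr Phi)) z)
      (hyp a r%:R)].
Proof.
move=> [nz hN _] aP r0 ya hy P Py.
have a0 := dot_gt0 (nz _ aP).
have aNa : a != - a.
  apply/eqP => /(congr1 (dot a)); rewrite dotNr => h; lra.
(* Lower bounds suffice, as [- b] supplies the upper bound of [b]. For [a] they leave the strip r -
   1 < <w,a> < r + 1, which contains [y] in its interior. *)
pose lo b : R := if b == a then r%:R - 1 else if b == - a then - r%:R - 1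
  else (ubnd y b)%:~R - 1.
have ubgt b : b \in Phi -> b != a -> b != - a -> (ubnd y b)%:~R - 1 < dot y b.
  move=> bP ba bNa; rewrite lt_neqAle ubnd_ge andbT; apply/eqP => h.
  by apply: (hy b bP ba bNa (ubnd y b - 1)); rewrite intrB -h.
have ubN b : b \in Phi -> b != a -> b != - a -> ubnd y (- b) = 1 - ubnd y b.
  move=> bP ba bNa; have := ubgt b bP ba bNa => h.
  by apply: ubnd_def; rewrite dotNr intrB; have := ubnd_gt y b; lra.
pose G w := forall b, b \in Phi -> lo b < dot w b.
have oG w : G w -> \forall z \near w, G z.
  move=> Gw; apply: (near_all_seq (P := fun b z => lo b < dot z b)) => b bP.
  exact/near_dot_gt/Gw.
have Gy : G y.
  move=> b bP; rewrite /lo; case: eqVneq => [->|ba]; first by rewrite ya; lra.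
  case: eqVneq => [->|bNa]; first by rewrite dotNr ya; lra.
  exact: ubgt.
have Gub w b : G w -> b \in Phi -> b != a -> b != - a -> ubnd w b = ubnd y b.
  move=> Gw bP ba bNa; apply: ubnd_def.
    by have := Gw b bP; rewrite /lo (negbTE ba) (negbTE bNa) => /ltW.
  have := Gw _ (hN _ bP).
  rewrite /lo eqr_oppLR (negbTE bNa) eqr_opp (negbTE ba) ubN//.
  by rewrite dotNr intrB; lra.
have Gub1 w : G w -> dot w a < r%:R -> ubnd w a = r%:Z.
  move=> Gw wr; apply: ubnd_def => //.
  by have := Gw a aP; rewrite /lo eqxx => /ltW.
have Gub2 w : G w -> dot w a < r%:R -> ubnd w (- a) = 1 - r%:Z.
  move=> Gw wr; apply: ubnd_def; rewrite dotNr intrB; first by lra.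
  by have := Gw a aP; rewrite /lo eqxx; lra.
have Ggt w : G w -> dot w a < r%:R ->
    forall b, b \in Phi -> (ubnd w b)%:~R - 1 < dot w b.
  move=> Gw wr b bP; have [->|ba] := eqVneq b a.
    by rewrite Gub1//; have := Gw a aP; rewrite /lo eqxx.
  have [->|bNa] := eqVneq b (- a).
    by rewrite Gub2// dotNr intrB; lra.
  by rewrite Gub//; have := Gw b bP; rewrite /lo (negbTE ba) (negbTE bNa).
have below w (Q : V -> Prop) e : (\forall z \near w, Q z) -> dot w a = r%:R ->
    0 < e -> exists2 s, `|s| < e & Q (w + s *: a) /\ dot (w + s *: a) a < r%:R.
  move=> Qw wa e0; have [e' e'0 he'] := near_line a Qw.
  pose d := Num.min e e' / 2.
  have me : 0 < Num.min e e' by rewrite lt_min e0.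
  have d0 : 0 < d by rewrite divr_gt0.
  have [h1 h2] : Num.min e e' <= e /\ Num.min e e' <= e'.
    by rewrite !ge_min !lexx orbT.
  have hd : d = Num.min e e' / 2 by [].
  exists (- d); first by rewrite normrN gtr0_norm//; lra.
  split; first by apply: he'; rewrite normrN gtr0_norm//; lra.
  by rewrite dotDl dotZl wa mulNr ltrBlDr ltrDl mulr_gt0.
have GPy : \forall z \near y, P z /\ G z.
  have Gy' := oG _ Gy.
  by near=> z; split; near: z.
have [s _ [[Pz Gz] zr]] := below y _ 1 GPy ya ltr01.
set z := y + s *: a in Pz Gz zr.
have cz : arr_complement (affine_arr Phi) z.
  move=> _ [b [m [bP ->]]].
  exact: between_nonint (Ggt _ Gz zr _ bP) (ubnd_gt _ _).
have mem w : G w -> dot w a < r%:R ->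
    connected_component (arr_complement (affine_arr Phi)) z w.
  move=> Gw wr; apply: alcove_ubnd => [||b bP]; [exact: Ggt|exact: Ggt|].
  have [->|ba] := eqVneq b a; first by rewrite !Gub1.
  have [->|bNa] := eqVneq b (- a); first by rewrite !Gub2.
  by rewrite !Gub.
exists z; split=> //; [exact: Gub1|by move=> b bP ba bNa; exact: Gub|].
apply: lt_ceiling => //; last first.
  move=> w /(alcoveP _ cz) /(_ a r aP) [_].
  by rewrite -[r%:~R]/(r%:R) => <-.
split; first by exists a, r.
exists y; split=> //.
have Gy' := oG _ Gy.
(* Lowering [w] slightly along [a] enters the alcove. *)
near=> w => wa; apply: (closure_line (v := a)) => e e0.
have Gw : \forall z \near w, G z by apply: oG; near: w.
have [t te [Gt tr]] := below w _ e Gw wa e0.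
by exists t => //; apply: mem.
Unshelve. all: by end_near.
Qed.

End Alcoves.

(** * The dominant region as a sign cell, and its unbounded directions *)

Section Region.
Variables (R : realType) (n : nat) (Phi S : seq 'rV[R]_n) (k : nat).
Variable Reg : set 'rV[R]_n.
Local Notation V := 'rV[R]_n.
Hypothesis HC : crystallographic_root_system Phi.
Hypothesis HS : simple_system Phi S.
Hypothesis Hreg : is_region (catalan_arr Phi k) Reg.
Hypothesis Hdom : dominant Phi S Reg.
Implicit Types (x y z w a b v : V) (r t : nat).

Let HD := crystallographic_diff_closed HC.

Lemma region_iff x y : Reg x -> Reg y <->
  (forall a r, a \in Phi -> (r <= k)%N ->
    dot y a <> r%:R /\ (dot x a < r%:R) = (dot y a < r%:R)).
Proof.
have [x0 [cx0 ->]] := Hreg; move=> /(catalanP _ cx0) h; rewrite catalanP//.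
split=> h' a r aP rk; have [h1 h2] := h a r aP rk; have [h3 h4] := h' a r aP rk.
  by split=> //; rewrite -h2 h4.
by split=> //; rewrite h2 h4.
Qed.

Lemma region_nonempty : exists x, Reg x.
Proof.
have [x [cx ->]] := Hreg; exists x; exact: connected_component_refl.
Qed.

Lemma region_near x : Reg x -> \forall y \near x, Reg y.
Proof.
move=> Rx.
have h : \forall y \near x, forall a, a \in Phi -> forall r,
    r \in iota 0 k.+1 ->
    dot y a <> r%:R /\ (dot x a < r%:R) = (dot y a < r%:R).
  apply: (near_all_seq (P := fun a y => forall r, r \in iota 0 k.+1 -> _)).
  move=> a aP; apply: (near_all_seq
    (P := fun r y => dot y a <> r%:R /\ (dot x a < r%:R) = (dot y a < r%:R))).
  move=> r; rewrite mem_iota => /andP[_ rk].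
  have [/eqP ne _] := (region_iff x Rx).1 Rx a r aP rk.
  have [xr|rx] := ltP (dot x a) r%:R.
    apply: filterS (near_dot_lt xr) => y yr; split; last by rewrite yr.
    by apply/eqP; rewrite lt_eqF.
  have rx' : r%:R < dot x a by rewrite lt_neqAle eq_sym ne.
  apply: filterS (near_dot_gt rx') => y yr; split.
    by apply/eqP; rewrite gt_eqF.
  by rewrite ltNge ltW.
apply: filterS h => y h; apply/(region_iff _ Rx) => a r aP rk.
by apply: h => //; rewrite mem_iota.
Qed.

(** A root with nonpositive coefficients is the negative of a positive one, so dominance makes it
    negative on [Reg]; one point thus decides positivity. *)
Lemma pos_rootP x a : Reg x -> pos_root Phi S a <-> a \in Phi /\ 0 < dot x a.
Proof.
move=> Rx; split=> [h|[aP a0]].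
  by split; [case: h|exact: Hdom h].
split=> //; have [_ _ h] := HS; have [_ hN _] := HD.
have [c [ac [c0|c0]]] := h a aP; first by exists c.
have : pos_root Phi S (- a).
  split; first exact: hN.
  exists (fun i => - c i); split; last by move=> i; rewrite oppr_ge0.
  by rewrite ac -sumrN; apply: eq_bigr => i _; rewrite scaleNr.
by move=> /(Hdom Rx); rewrite dotNr; lra.
Qed.

(** No hyperplane of level i <= k separates points of [Reg], so one point tests membership. This
    supplies [HI] in the section on decompositions. *)
Lemma thetaP x i a : Reg x -> theta Phi S k Reg i a <->
  [/\ (0 < i <= k)%N, a \in Phi, 0 < dot x a & dot x a < i%:R].
Proof.
move=> Rx; rewrite /theta; case: ifPn => [ik|_]; last by split=> // -[].
split=> [[aP h]|[_ aP a0 ai]].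
  by have [? ?] := (pos_rootP a Rx).1 aP; split=> //; exact: h.
split=> [|y]; first exact/(pos_rootP _ Rx).
move=> /(region_iff _ Rx) /(_ a i aP) h.
by have [_ <-] := h (andP ik).2.
Qed.

Lemma region_root_neq0 x a : Reg x -> a \in Phi -> dot x a != 0.
Proof.
move=> Rx aP; have [h _] := (region_iff x Rx).1 Rx a 0%N aP isT.
exact/eqP.
Qed.

Lemma theta_bound i a y : theta Phi S k Reg i a -> Reg y ->
  0 < dot y a /\ dot y a < i%:R.
Proof. by move=> h Ry; case/(thetaP _ _ Ry): h. Qed.

Lemma simple_pos_root (i : 'I_(size S)) : pos_root Phi S S`_i.
Proof.
have [sub _ _] := HS; split; first exact/sub/mem_nth.
exists (fun j => (j == i)%:R); split; last by move=> j; rewrite ler0n.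
rewrite (bigD1 i)//= eqxx scale1r big1 ?addr0// => j /negbTE ->.
by rewrite scale0r.
Qed.

(* [v] is the sum of the fundamental coweights of the simple roots occurring
   in no element of the ideals, so it spans directions along which the region
   is unbounded. *)
Lemma recession_vector : exists v,
  [/\ forall a, pos_root Phi S a -> 0 <= dot v a,
      forall i a, theta Phi S k Reg i a -> dot v a = 0 &
      forall a, pos_root Phi S a -> dot v a = 0 ->
        exists C, forall y, Reg y -> dot y a <= C].
Proof.
pose supp (i : 'I_(size S)) := exists a r (c : 'I_(size S) -> R),
  [/\ theta Phi S k Reg r a, a = \sum_(j < size S) c j *: S`_j,
      forall j, 0 <= c j & 0 < c i].
pose f i : R := if `[< supp i >] then 0 else 1.
have [_ li _] := HS.
have [v hv] := dual_vector f li.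
have f0 i : 0 <= f i by rewrite /f; case: ifP.
have dotv (c : 'I_(size S) -> R) :
    dot v (\sum_(i < size S) c i *: S`_i) = \sum_(i < size S) c i * f i.
  by rewrite dot_sumr; apply: eq_bigr => i _; rewrite dotZr hv.
exists v; split=> [a [_ [c [-> c0]]]|r a ra|a [aP [c [ac c0]]] va].
- by rewrite dotv sumr_ge0// => i _; rewrite mulr_ge0.
- have [x Rx] := region_nonempty.
  have [/(pos_rootP _ Rx) [_ [c [ac c0]]] _] :
      (a \in Phi /\ 0 < dot x a) /\ True by case/(thetaP _ _ Rx): ra.
  rewrite ac dotv big1// => i _; rewrite /f.
  have [ci|ci] := ltP 0 (c i); last first.
    by have -> : c i = 0 by [apply/eqP; rewrite eq_le ci c0]; rewrite mul0r.
  suff -> : `[< supp i >] by rewrite mulr0.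
  by apply/asboolP; exists a, r, c; rewrite -ac.
have cf i : c i * f i = 0.
  move: va => /eqP; rewrite ac dotv psumr_eq0; last first.
    by move=> j _; rewrite mulr_ge0.
  by move=> /allP /(_ i (mem_index_enum _)) /eqP.
(* A simple root in the support of some [a'] in an ideal is bounded because the other terms of [a']
   are nonnegative on [Reg]; for the rest [c i = 0]. *)
have bnd i : exists C, forall y, Reg y -> c i * dot y S`_i <= C.
  have := cf i; rewrite /f; case: asboolP => [|_]; last first.
    by rewrite mulr1 => ->; exists 0 => y _; rewrite mul0r.
  move=> [a' [r [c' [ra' ac' c'0 ci]]]] _; exists (c i * (r%:R / c' i)) => y Ry.
  apply: ler_wpM2l => //; rewrite ler_pdivlMr// mulrC.
  have [_ /ltW] := theta_bound ra' Ry; apply: le_trans.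
  rewrite ac' dot_sumr (bigD1 i)//= dotZr lerDl sumr_ge0// => j _.
  by rewrite dotZr mulr_ge0// ltW// (Hdom Ry (simple_pos_root j)).
have [C hC] := choice bnd.
exists (\sum_i C i) => y Ry; rewrite ac dot_sumr; apply: ler_sum => i _.
by rewrite dotZr hC.
Qed.

Lemma proportional_roots q a b : a \in Phi -> b \in Phi -> b = q *: a ->
  b = a \/ b = - a.
Proof.
move=> aP bP e; have [_ _ _ hred _] := HC.
have qP : q *: a \in Phi by rewrite -e.
have [h|h] := hred a q aP qP.
  by left; rewrite e h scale1r.
by right; rewrite e h scaleN1r.
Qed.

Lemma double_root a : a \in Phi -> a + a \notin Phi.
Proof.
move=> aP; apply/negP => aaP; have [_ _ _ hred _] := HC.
have := hred a 2 aP; rewrite scaler_nat mulr2n => /(_ aaP).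
by case; lra.
Qed.

Lemma root_neq0 a : a \in Phi -> a != 0.
Proof. by have [nz _ _] := HD; exact: nz. Qed.

Lemma zero_notin_roots : 0 \notin Phi.
Proof. by apply/negP => /root_neq0; rewrite eqxx. Qed.

(** * From ceilings to indecomposable elements, and from alcoves to the region *)

Local Notation I := (theta Phi S k Reg).

(** Near the facet <.,a> exceeds r - 1 on [Reg], which excludes a total rank below [r]. A failure of
    (ii) or (iii) makes <.,b> constant on an open piece of the facet, so that [b] is [a] or [- a],
    and both are impossible. *)
Lemma ceiling_indecomposable a r : pos_root Phi S a -> (1 <= r <= k)%N ->
  ceiling (catalan_arr Phi k) Reg (hyp a r%:R) ->
  rank_indecomposable Phi S I k a r.
Proof.
move=> apos rk hc; have [r0 rk'] := andP rk.
have [x0 Rx0] := region_nonempty.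
have [aP _] := (pos_rootP _ Rx0).1 apos.
have Rlt y : Reg y -> dot y a < r%:R by exact: ceiling_lt r0 hc.
have Ia : I r a.
  by apply/(thetaP _ _ Rx0); split=> //; [case/(pos_rootP _ Rx0): apos|exact: Rlt].
have [[_ [y [ya hy]]] _ _] := hc.
have const b (c : R) : (forall w, dot w a = r%:R -> closure Reg w ->
    dot w b = c) -> exists q, b = q *: a.
  move=> h; apply: (perp_const (x := y) (c := c)); first exact: root_neq0.
  apply: filterS hy => w hw; rewrite ya => wa; apply: h => //.
  exact: hw.
have cge (b : V) (c : R) w : (forall z, Reg z -> c <= dot z b) ->
    closure Reg w -> c <= dot w b.
  move=> h cw; have := @closure_dot_le _ _ Reg (- b) (- c) w _ cw.
  by rewrite dotNr lerN2; apply => z Rz; rewrite dotNr lerN2 h.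
split=> //.
- split; first exact: (rdecomp1 (fun i b => thetaP i b Rx0)).
  move=> t D; rewrite leqNgt; apply/negP => tr.
  have cy : closure Reg y by exact: (nbhs_singleton hy).
  have hr : r.-1%:R < dot y a by rewrite ya ltr_nat; lia.
  have [z [Rz hz]] := cy _ (near_dot_gt hr).
  have [_ zt] := rdecomp_bound (fun i b => thetaP i b Rz) D.
  have : t%:R <= r.-1%:R :> R by rewrite ler_nat; lia.
  by move: hz zt => /=; lra.
- move=> i j ij [b [c [Ib Ic e]]].
  have bP : b \in Phi by case/(thetaP _ _ Rx0): Ib.
  have cP : c \in Phi by case/(thetaP _ _ Rx0): Ic.
  have [q hq] : exists q, b = q *: a.
    apply: (const b i%:R) => w wa cw; apply/eqP; rewrite eq_le; apply/andP; split.
      by apply: closure_dot_le cw => z Rz; have [_ /ltW] := theta_bound Ib Rz.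
    have : dot w c <= j%:R.
      by apply: closure_dot_le cw => z Rz; have [_ /ltW] := theta_bound Ic Rz.
    by move: wa; rewrite -ij natrD e dotDr; lra.
  have [_ b0] := (thetaP _ _ Rx0).1 Ib.
  case: (proportional_roots aP bP hq) => hb.
    by move: cP; rewrite (_ : c = 0) ?(negbTE zero_notin_roots)//; move: e; rewrite hb -{1}[a]addr0 => /addrI.
  case/(pos_rootP _ Rx0): apos => _; have [_ _ + _] := (thetaP _ _ Rx0).1 Ib.
  by rewrite hb dotNr; lra.
- move=> b t bpos abpos [D _] tk.
  have [bP b0] := (pos_rootP _ Rx0).1 bpos.
  have [abP ab0] := (pos_rootP _ Rx0).1 abpos.
  apply: contrapT => nI.
  (* For t <= r this is mere positivity; otherwise it restates that [b] is not in I_{t-r}. *)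
  have bge z : Reg z -> t%:R - r%:R <= dot z b.
    move=> Rz; have [_ zb0] := (pos_rootP _ Rz).1 bpos.
    have [tr|rt] := leqP t r.
      by have : t%:R <= r%:R :> R; [rewrite ler_nat|lra].
    rewrite -natrB; last exact: ltnW.
    rewrite leNgt; apply/negP => h; apply/nI/(thetaP _ _ Rz).
    by split=> //; lia.
  have [q hq] : exists q, b = q *: a.
    apply: (const b (t%:R - r%:R)) => w wa cw.
    apply/eqP; rewrite eq_le (cge b _ w bge cw) andbT.
    have : dot w (a + b) <= t%:R.
      apply: closure_dot_le cw => z Rz.
      by have [_ /ltW] := rdecomp_bound (fun i c => thetaP i c Rz) D.
    by rewrite dotDr wa; lra.
  case: (proportional_roots aP bP hq) => hb.
    by move: abP; rewrite hb (negbTE (double_root aP)).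
  by move: abP; rewrite hb subrr (negbTE zero_notin_roots).
Qed.

(** The facet of [B] lies in the closure of [Reg], and [Reg] stays on one side of the hyperplane. *)
Lemma alcove_ceiling_region B a r : B `<=` Reg -> (exists x, B x) ->
  (1 <= r <= k)%N -> a \in Phi ->
  ceiling (affine_arr Phi) B (hyp a r%:R) ->
  ceiling (catalan_arr Phi k) Reg (hyp a r%:R).
Proof.
move=> BR [x Bx] /andP[r0 rk] aP hc.
apply: lt_ceiling => //.
  have [[_ [y [ya hy]]] _ _] := hc.
  split; first by exists a, r.
  exists y; split=> //; apply: filterS hy => w hw /hw.
  exact: closure_subset.
have xr := ceiling_lt r0 hc Bx.
move=> y /(region_iff _ (BR _ Bx)) /(_ a r aP rk) [_ <-].
exact: xr.
Qed.

Lemma alcove_sub_region x : Reg x -> arr_complement (affine_arr Phi) x ->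
  connected_component (arr_complement (affine_arr Phi)) x `<=` Reg.
Proof.
move=> Rx cx y /(alcoveP _ cx) h; apply/(region_iff _ Rx) => a r aP rk.
exact: (h a r aP).
Qed.

(** * Choice of the base point and walks from it *)

Lemma region_pos_iff x y : Reg x ->
  (forall a r, pos_root Phi S a -> (r <= k)%N ->
    dot y a <> r%:R /\ (dot x a < r%:R) = (dot y a < r%:R)) -> Reg y.
Proof.
move=> Rx h; apply/(region_iff _ Rx) => a r aP rk.
have [xa|xa] := ltP 0 (dot x a); first by apply: h => //; exact/(pos_rootP _ Rx).
have {}xa : dot x a < 0 by rewrite lt_neqAle xa region_root_neq0.
have [_ hN _] := HD.
have Napos : pos_root Phi S (- a).
  by apply/(pos_rootP _ Rx); split; [exact: hN|rewrite dotNr; lra].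
(* Level 0 of [- a] gives <y,a> < 0, so [y] lies below every level of [a], as [x] does. *)
have := h (- a) 0%N Napos isT; rewrite mulr0n !dotNr !oppr_lt0 => -[y0].
rewrite [0 < dot x a]ltNge (ltW xa) /= => /esym /negbT; rewrite -leNgt => ya.
have {}ya : dot y a < 0.
  by rewrite lt_neqAle ya andbT; apply/eqP => e; apply: y0; rewrite e oppr0.
have r0 : 0 <= r%:R :> R by rewrite ler0n.
split; first by apply/eqP; rewrite lt_eqF//; lra.
by rewrite (lt_le_trans xa r0) (lt_le_trans ya r0).
Qed.

(** Were <x,a> below [r], [a] would lie in I_r, which [v] annihilates. *)
Lemma unbounded_gt v x a r : (forall i b, I i b -> dot v b = 0) ->
  Reg x -> pos_root Phi S a -> dot v a != 0 -> (r <= k)%N -> r%:R < dot x a.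
Proof.
move=> hI Rx apos va rk; have [aP a0] := (pos_rootP _ Rx).1 apos.
have [xr _] := (region_iff x Rx).1 Rx a r aP rk.
rewrite lt_neqAle eq_sym; apply/andP; split; first exact/eqP.
rewrite leNgt; apply/negP => xar; move: va; rewrite (hI r) ?eqxx//.
apply/(thetaP _ _ Rx); split=> //; rewrite rk andbT lt0n.
by apply/eqP => r0; move: xar; rewrite r0; lra.
Qed.

(** Moving along [v] only raises positive roots already above every level up to [k]. *)
Lemma region_shift v x (L : R) : (forall a, pos_root Phi S a -> 0 <= dot v a) ->
  (forall i b, I i b -> dot v b = 0) -> Reg x -> 0 <= L -> Reg (x + L *: v).
Proof.
move=> v0 hI Rx L0; apply: (region_pos_iff Rx) => a r apos rk.
rewrite dotDl dotZl; have [va|va] := eqVneq (dot v a) 0.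
  rewrite va mulr0 addr0; apply: ((region_iff x Rx).1 Rx) => //.
  by case: apos.
have ra := unbounded_gt hI Rx apos va rk.
have Lv : 0 <= L * dot v a by rewrite mulr_ge0// v0.
split; first by apply/eqP; rewrite gt_eqF//; lra.
by rewrite !ltNge (ltW ra) /=; symmetry; apply/negbF; lra.
Qed.

(** For [v] from [recession_vector] these are the positive roots bounded on [Reg]. *)
Definition bounded_roots v : seq V :=
  [seq a <- Phi | (dot v a == 0) && `[< pos_root Phi S a >]].

Lemma mem_bounded_roots v a :
  a \in bounded_roots v <-> pos_root Phi S a /\ dot v a = 0.
Proof.
rewrite mem_filter; split=> [/andP[/andP[/eqP va /asboolP//]]|[apos va]].
by rewrite va eqxx; case: (apos) => -> _; rewrite andbT; exact/asboolP.
Qed.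

Lemma ubnd_sum_bounded (s : seq V) :
  (forall a, a \in s -> pos_root Phi S a /\
    exists C, forall y, Reg y -> dot y a <= C) ->
  exists M : int, forall y, Reg y -> 0 <= \sum_(a <- s) ubnd y a <= M.
Proof.
elim: s => [_|a s IH h]; first by exists 0 => y _; rewrite big_nil lexx.
have [|M hM] := IH; first by move=> b bs; apply: h; rewrite in_cons bs orbT.
have [apos [C hC]] := h a (mem_head _ _).
exists (Num.floor C + 1 + M) => y Ry; rewrite big_cons.
have /andP[s0 sM] := hM y Ry.
have u0 : 0 < ubnd y a.
  by rewrite -(ltr_int R); apply: lt_trans (ubnd_gt _ _); exact: (Hdom Ry apos).
have uC : ubnd y a <= Num.floor C + 1.
  by apply: ubnd_le; apply: le_lt_trans (hC y Ry) (floorD1_gt _).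
by apply/andP; split; [rewrite addr_ge0// ltW|exact: lerD].
Qed.

(** Start from a maximizer [x1] of the sum; moving along [v] to [x2] leaves the bounded roots
    unchanged, and the final perturbation does not lower the sum. *)
Lemma base_point v :
  (forall a, pos_root Phi S a -> 0 <= dot v a) ->
  (forall i a, I i a -> dot v a = 0) ->
  (forall a, pos_root Phi S a -> dot v a = 0 ->
    exists C, forall y, Reg y -> dot y a <= C) ->
  exists x, [/\ Reg x,
    forall a b, a \in Phi -> b \in Phi -> a + b != 0 ->
      forall m : int, dot x (a + b) <> m%:~R,
    forall y, Reg y -> \sum_(a <- bounded_roots v) ubnd y a <=
      \sum_(a <- bounded_roots v) ubnd x a
    & forall a d, pos_root Phi S a -> d \in Phi -> dot v a != 0 ->
      k%:R + `|dot d a| / dot d d < dot x a].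
Proof.
move=> v0 hI hC; have [x0 Rx0] := region_nonempty.
have [|M hM] := @ubnd_sum_bounded (bounded_roots v).
  by move=> a /mem_bounded_roots[apos va]; split=> //; exact: hC.
have [x1 Rx1 x1max] := int_max Rx0 hM.
pose pairs := [seq (a, d) | a <- Phi, d <- Phi].
(* Leaves room for the change of <.,p.1> during a walk to the foot of [p.2]. *)
pose far (p : V * V) := k%:R + `|dot p.2 p.1| / dot p.2 p.2.
have [L L0 hL] := large_multiple pairs (fun p => dot v p.1) far.
pose x2 := x1 + L *: v.
have Rx2 : Reg x2 by exact: region_shift.
pose lo (p : V * V) := if dot v p.1 == 0 then (ubnd x1 p.1)%:~R - 1 else far p.
pose U y := Reg y /\ forall p, p \in pairs -> pos_root Phi S p.1 ->
  lo p < dot y p.1.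
have oU y : U y -> \forall z \near y, U z.
  move=> [Ry hy]; have h1 := region_near Ry.
  have h2 : \forall z \near y, forall p, p \in pairs ->
      pos_root Phi S p.1 -> lo p < dot z p.1.
    apply: (near_all_seq (P := fun p z => pos_root Phi S p.1 -> lo p < dot z p.1)).
    move=> p pp; have [ppos|npos] := pselect (pos_root Phi S p.1).
      by apply: filterS (near_dot_gt (hy p pp ppos)) => z + _.
    by near=> z => /npos.
  by near=> z; split; near: z.
have [x3 Ux3] : exists y, U y.
  have [e e0 he] := near_line x1 (region_near Rx2).
  have e2 : 0 < e / 2 by rewrite divr_gt0.
  (* Positive roots are positive at [x1], so a small step along it makes the weak inequalities at
     [x2] strict. *)
  exists (x2 + (e / 2) *: x1); split.
    by apply: he; rewrite gtr0_norm//; lra.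
  move=> p pp ppos; rewrite dotDl dotZl.
  have p0 := Hdom Rx1 ppos.
  have h3 : 0 < e / 2 * dot x1 p.1 by rewrite mulr_gt0.
  suff : lo p <= dot x2 p.1 by lra.
  rewrite /lo dotDl dotZl; case: eqVneq => [->|vp].
    by rewrite mulr0 addr0 ubnd_ge.
  have vp0 : 0 < dot v p.1 by rewrite lt_neqAle eq_sym vp v0.
  by have := hL p pp vp0; lra.
(* Sums of two roots are what [foot_nonint] tests; doubled roots among them make every <x,b>
   nonintegral. *)
have [|x [Rx hx] gx] := @generic_point _ _ U
    [seq p.1 + p.2 | p <- pairs & p.1 + p.2 != 0] x3 oU Ux3.
  by move=> u /mapP[p]; rewrite mem_filter => /andP[p0 _] ->.
exists x; split=> //.
- move=> a b aP bP ab; apply: gx; apply/mapP; exists (a, b) => //.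
  by rewrite mem_filter ab; exact: allpairs_f.
- move=> y Ry; apply: le_trans (x1max y Ry) _.
  rewrite big_seq [leRHS]big_seq; apply: ler_sum => a /mem_bounded_roots[apos va].
  have aP : a \in Phi by case: apos.
  have := hx (a, a) (allpairs_f _ aP aP) apos; rewrite /lo /= va eqxx => h.
  suff : ubnd x1 a - 1 < ubnd x a by lia.
  by rewrite -(ltr_int R) intrB; apply: lt_trans (ubnd_gt x a).
- move=> a d apos dP va; have aP : a \in Phi by case: apos.
  by have := hx (a, d) (allpairs_f _ aP dP) apos; rewrite /lo /= (negbTE va).
Unshelve. all: by end_near.
Qed.

(** If <.,b> were [m] at the foot, <x, b + s_d(b)> would be 2m - k_d q with [q] the Cartan integer;
    and b + s_d(b) = 0 only when [b] is proportional to [d]. *)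
Lemma foot_nonint x : (forall a b, a \in Phi -> b \in Phi -> a + b != 0 ->
    forall m : int, dot x (a + b) <> m%:~R) ->
  forall d b, d \in Phi -> b \in Phi -> b != d -> b != - d ->
  forall m : int, dot (foot x d) b <> m%:~R.
Proof.
move=> gx d b dP bP bd bNd m; have [_ _ hrefl hred hint] := HC.
have [q hq] := hint d b dP bP.
have dd : dot d d != 0 by rewrite dot_eq0 root_neq0.
rewrite /foot dotDl dotZl => e.
have rP := hrefl d b dP bP.
apply: (gx b (refl d b) bP rP _ (2 * m - ubnd x d * q)); last first.
  rewrite intrB !intrM -hq -e /refl !dotDr dotNr dotZr [dot d b]dotC.
  by field.
apply/eqP => h0.
have hb : b = (q%:~R / 2) *: d.
  have : 2 *: b = q%:~R *: d.
    by apply/eqP; rewrite -subr_eq0 scaler_nat mulr2n -addrA -hq; exact/eqP.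
  by move=> /(congr1 ( *:%R 2^-1)); rewrite !scalerA mulVf// scale1r mulrC.
by case: (proportional_roots dP bP hb) => /eqP; exact/negP.
Qed.

Lemma dot_foot x d : d \in Phi -> dot (foot x d) d = (ubnd x d)%:~R.
Proof.
move=> dP; rewrite /foot dotDl dotZl mulfVK ?dot_eq0 ?root_neq0//.
by rewrite addrC subrK.
Qed.

(** As k_d - <x,d> <= 1, the walk moves by at most 1 / <d,d> times [d]. *)
Lemma foot_far x d a : d \in Phi ->
  k%:R + `|dot d a| / dot d d < dot x a -> k%:R < dot (foot x d) a.
Proof.
move=> dP xa; have d0 := dot_gt0 (root_neq0 dP).
rewrite /foot dotDl dotZl.
pose t := ((ubnd x d)%:~R - dot x d) / dot d d; rewrite -/t.
have t0 : 0 <= t by rewrite divr_ge0 ?ltW// subr_gt0 ubnd_gt.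
have t1 : t <= (dot d d)^-1.
  rewrite -[leRHS]mul1r ler_pM2r ?invr_gt0//.
  by have := ubnd_ge x d; lra.
have : `|t * dot d a| <= `|dot d a| / dot d d.
  by rewrite normrM ger0_norm// mulrC ler_wpM2l.
by rewrite ler_norml => /andP[h _]; lra.
Qed.

(** * The alcove below the hyperplane of an indecomposable root *)

Lemma indecomposable_alcove a r : (0 < r)%N -> pos_root Phi S a ->
  rank_indecomposable Phi S I k a r ->
  exists z, [/\ Reg z, arr_complement (affine_arr Phi) z &
    ceiling (affine_arr Phi)
      (connected_component (arr_complement (affine_arr Phi)) z)
      (hyp a r%:R)].
Proof.
move=> r0 apos [Ia [_ amin] aind asum].
have [v [v0 hI hC]] := recession_vector.
have [x [Rx gx xmax xfar]] := base_point v0 hI hC.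
have [_ hN _] := HD.
have nonint b : b \in Phi -> forall m : int, dot x b <> m%:~R.
  move=> bP m e; apply: (gx b b bP bP _ (m + m)).
    apply/eqP => /(congr1 (dot b)); rewrite dotDr dot0r.
    by have := dot_gt0 (root_neq0 bP); lra.
  by rewrite dotDr e intrD.
pose Psi := [seq b <- Phi | dot v b == 0].
have PsiPhi : {subset Psi <= Phi} by move=> b; rewrite mem_filter => /andP[].
have pos_neq d b : pos_root Phi S d -> pos_root Phi S b -> b != - d.
  move=> /(Hdom Rx) d0 /(Hdom Rx) b0; apply/eqP => e.
  by move: b0; rewrite e dotNr; lra.
have posx b : b \in Phi -> 0 < dot x b -> pos_root Phi S b.
  by move=> bP b0; apply/(pos_rootP _ Rx).
have farlt b y t : (t <= k)%N -> pos_root Phi S b -> dot v b != 0 ->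
    k%:R < dot y b ->
    dot y b <> t%:R /\ (dot x b < t%:R) = (dot y b < t%:R).
  move=> tk bpos vb yb; have tkR : t%:R <= k%:R :> R by rewrite ler_nat.
  have xb := unbounded_gt hI Rx bpos vb tk.
  split; first by apply/eqP; rewrite gt_eqF//; lra.
  by rewrite !ltNge (ltW xb) /=; symmetry; apply/negbF; lra.
have hwall d : d \in Psi -> 0 < dot x d ->
    (forall b, b \in Psi -> b != d -> b != - d ->
      ubnd (foot x d) b = ubnd x b) -> ubnd x d <= k%:Z.
  move=> dPsi d0 same; rewrite leNgt; apply/negP => kd.
  have dP := PsiPhi _ dPsi; have dpos := posx d dP d0.
  have vd : dot v d = 0 by move: dPsi; rewrite mem_filter => /andP[/eqP].
  have kd' : k%:R <= (ubnd x d)%:~R - 1 :> R.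
    by rewrite -(intrB R _ 1) -[k%:R]/((Posz k)%:~R : R) ler_int; lia.
  (* As <x,d> >= k_d - 1 >= k, the walk crosses no Catalan hyperplane; at the foot k_d has grown and
     the other bounded roots keep theirs, against maximality. *)
  have Ry : Reg (foot x d).
    apply: (region_pos_iff Rx) => b t bpos tk.
    have bP : b \in Phi by case: bpos.
    have tkR : t%:R <= k%:R :> R by rewrite ler_nat.
    have [vb|vb] := eqVneq (dot v b) 0; last first.
      by apply: farlt => //; apply: foot_far => //; exact: xfar.
    have [->|bd] := eqVneq b d.
      rewrite dot_foot//; have := ubnd_ge x d => xd.
      split; first by apply/eqP; rewrite gt_eqF//; lra.
      by rewrite !ltNge; congr negb; apply/idP/idP => _; lra.
    have bNd := pos_neq _ _ dpos bpos.
    split; first exact: (foot_nonint gx dP bP bd bNd (m := t)).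
    rewrite -[t%:R]/((Posz t)%:~R : R) !ubnd_ltE same//.
    by rewrite mem_filter vb eqxx.
  have := xmax _ Ry; rewrite leNgt => /negP; apply.
  have dbd : d \in bounded_roots v by exact/mem_bounded_roots.
  have dlt : ubnd x d < ubnd (foot x d) d.
    by rewrite -(ltr_int R) -[ltLHS](dot_foot x dP) ubnd_gt.
  apply: (ltr_sum_seq dbd) => // b /mem_bounded_roots[bpos vb].
  have [->|bd] := eqVneq b d; first exact: ltW.
  rewrite same// ?pos_neq// mem_filter vb eqxx.
  by case: bpos.
have aP : a \in Phi by case: apos.
have va := hI _ _ Ia.
have aPsi : a \in Psi by rewrite mem_filter va eqxx.
have thx i b := thetaP i b Rx.
have hx0 b : b \in Phi -> dot x b != 0 by exact: region_root_neq0.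
have [ur same] := indecomposable_wall HD hx0 thx (diff_closed_orth v HD)
  PsiPhi (fun b bP => nonint b (PsiPhi _ bP))
  (fun d dP b bP => foot_nonint gx (PsiPhi _ dP) (PsiPhi _ bP)) hwall
  aPsi Ia amin aind
  (fun b t bP pb abP pab => asum b t (posx b bP pb) (posx _ abP pab)).
have ya : dot (foot x a) a = r%:R by rewrite dot_foot// ur.
(* An open condition true at the foot; it controls the unbounded roots at the nearby alcove point
   [z]. *)
pose far z := forall b, b \in Phi -> pos_root Phi S b -> dot v b != 0 ->
  k%:R < dot z b.
have near_far : \forall z \near foot x a, far z.
  apply: (near_all_seq (P := fun b z => pos_root Phi S b -> dot v b != 0 -> _)).
  move=> b bP; have [bpos|npos] := pselect (pos_root Phi S b); last first.
    by near=> z => /npos.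
  have [vb|vb] := eqVneq (dot v b) 0; first by near=> z.
  have h := foot_far aP (xfar b a bpos aP vb).
  by apply: filterS (near_dot_gt h) => z + _ _.
have [z [farz cz uza uz hc]] := alcove_below HD aP r0 ya
  (fun b bP => foot_nonint gx aP bP) near_far.
exists z; split=> //; apply: (region_pos_iff Rx) => b t bpos tk.
have bP : b \in Phi by case: bpos.
have [vb|vb] := eqVneq (dot v b) 0; last by apply: farlt => //; exact: farz.
have Hb : affine_arr Phi (hyp b t%:R) by exists b, t%:Z.
split; first exact: (cz _ Hb).
rewrite -[t%:R]/((Posz t)%:~R : R) !ubnd_ltE.
have [->|ba] := eqVneq b a; first by rewrite uza ur.
have bNa := pos_neq _ _ apos bpos.
by rewrite uz// same// mem_filter vb eqxx.
Unshelve. all: by end_near.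
Qed.

Lemma region_alcove : exists z, Reg z /\ arr_complement (affine_arr Phi) z.
Proof.
have [x Rx] := region_nonempty.
have [z Rz hz] := generic_point region_near Rx root_neq0.
by exists z; split=> // _ [b [m [bP ->]]]; exact: hz.
Qed.
End Region.

(** * The equivalences, with one alcove for all [r] *)

Theorem theorem4 (R : realType) (n : nat) (Phi S : seq 'rV[R]_n) (k : nat)
    (Reg : set 'rV[R]_n) (alpha : 'rV[R]_n) :
  irreducible_crystallographic_root_system Phi ->
  simple_system Phi S ->
  (0 < k)%N ->
  is_region (catalan_arr Phi k) Reg ->
  dominant Phi S Reg ->
  pos_root Phi S alpha ->
  exists B : set 'rV[R]_n,
    [/\ is_region (affine_arr Phi) B, B `<=` Reg &
      forall r : nat, (1 <= r <= k)%N ->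
        (ceiling (catalan_arr Phi k) Reg (hyp alpha r%:R) <->
           rank_indecomposable Phi S (theta Phi S k Reg) k alpha r) /\
        (rank_indecomposable Phi S (theta Phi S k Reg) k alpha r <->
           ceiling (affine_arr Phi) B (hyp alpha r%:R))].
Proof.
move=> [HC _] HS _ Hreg Hdom apos.
have aP : alpha \in Phi by case: apos.
pose alcove z := connected_component (arr_complement (affine_arr Phi)) z.
suff [z [Rz cz hz]] : exists z, [/\ Reg z, arr_complement (affine_arr Phi) z &
    forall r, (1 <= r <= k)%N ->
      rank_indecomposable Phi S (theta Phi S k Reg) k alpha r ->
      ceiling (affine_arr Phi) (alcove z) (hyp alpha r%:R)].
  have sub : alcove z `<=` Reg by exact: (alcove_sub_region Hreg Rz cz).
  exists (alcove z); split=> //; first by exists z.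
  have zz : exists x, alcove z x.
    by exists z; exact: connected_component_refl.
  move=> r rk.
  have h12 := ceiling_indecomposable HC HS Hreg Hdom apos rk.
  have h31 := alcove_ceiling_region Hreg sub zz rk aP.
  have h23 := hz r rk.
  by split; split=> h; auto.
(* The rank of [alpha] is unique, so the alcove built for one [r] serves all; if there is none, any
   alcove in [Reg] does. *)
have [[r [rk ind]]|none] := pselect (exists r, (1 <= r <= k)%N /\
    rank_indecomposable Phi S (theta Phi S k Reg) k alpha r).
  have [z [Rz cz hz]] :=
    indecomposable_alcove HC HS Hreg Hdom (andP rk).1 apos ind.
  exists z; split=> // r' _ [_ [D' min'] _ _].
  have [_ [D min] _ _] := ind.
  suff -> : r' = r by [].
  by apply/eqP; rewrite eqn_leq min'// min.
have [z [Rz cz]] := region_alcove HC Hreg.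
by exists z; split=> // r rk ind; case: none; exists r.
Qed.
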